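(* Suppose the random vector $(X,K_A)$ is regularly varying with noninteger index $\alpha>1$, and that $\mathbb{E}[X]\neq 0$. Let $(X_j)_{j\ge1}$ be i.i.d. copies of $X$, independent of $(X,K_A)$, and let $D^{R}$ be a random variable with $$D^{R}\overset{d}{=} X+\sum_{j=1}^{K_A}X_j .$$ Then $D^{R}$ is regularly varying with the same index $\alpha$. More specifically, $$\mathbb{P}(D^{R}>x)\sim \mathbb{P}(X+\mathbb{E}[X]K_A>x)+\mathbb{E}[K_A]\,\mathbb{P}(X>x),\qquad x\to\infty .$$
   Context: Setting (generic cluster of the renewal Poisson cluster process): $A$ is the random mark of an immigrant event, with values in a measurable space $\mathbb{A}$; $X=f(A)$ for a measurable $f:\mathbb{A}\to[0,\infty)$, so $X\ge 0$; $K_A$ is a random variable with values in $\{0,1,2,\dots\}$ (the number of offspring), which may depend on $X$. The offspring have transformed marks $X_j$. $D^R$ is the sum of the transformed marks in a generic cluster. Notation: $f(x)\sim g(x)$ as $x\to\infty$ means $\lim_{x\to\infty} f(x)/g(x)=1$. Regular variation: a nonnegative random variable $Z$ is regularly varying with index $\alpha>0$ if $\mathbb{P}(Z>x)=x^{-\alpha}L(x)$ for $x>0$, with $L$ slowly varying at infinity. A random vector $\mathbf{X}$ in $\mathbb{R}^2$ is regularly varying with index $\alpha>0$ if (for some norm $|\cdot|$) $|\mathbf{X}|$ is regularly varying with index $\alpha$ and, for a sequence $(a_n)$ with $n\mathbb{P}(|\mathbf{X}|>a_n)\to1$, the measures $n\mathbb{P}(a_n^{-1}\mathbf{X}\in\cdot)$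 converge vaguely on $\mathbb{R}^2\setminus\{(0,0)\}$ to a non-null Radon measure $\mu$ (finite on Borel sets bounded away from the origin). *)

(* Defs.v *)
From HB Require Import structures.
From mathcomp Require Import all_boot all_order all_algebra finmap.
From mathcomp Require Import all_classical all_reals all_analysis.
Import Order.TTheory GRing.Theory Num.Theory.
Import numFieldNormedType.Exports.

Set Implicit Arguments.
Unset Strict Implicit.
Unset Printing Implicit Defensive.

Local Open Scope classical_set_scope.
Local Open Scope ring_scope.

(* If [g] vanishes at arbitrarily large arguments the quotient is 0 there
   (division by zero), so the limit cannot be 1: no junk case is admitted. *)
Definition asymp_equiv (R : realType) (f g : R -> R) : Prop :=
  f x / g x @[x --> +oo] --> (1 : R).

Definition slowly_varying (R : realType) (L : R -> R) : Prop :=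
  [/\ measurable_fun [set x : R | 0 < x] L,
      (\forall x \near +oo, 0 < L x) &
      forall t : R, 0 < t -> L (t * x) / L x @[x --> +oo] --> (1 : R)].

(* Nonnegativity is only asked almost surely, so that the notion depends on
   the law of [Z] alone. *)
Definition regularly_varying (d : measure_display) (T : measurableType d)
    (R : realType) (P : probability T R) (Z : T -> R) (alpha : R) : Prop :=
  [/\ 0 < alpha,
      {ae P, forall w, 0 <= Z w} &
      exists2 L : R -> R, slowly_varying L &
        forall x : R, 0 < x ->
          P [set w | x < Z w] = (x `^ (- alpha) * L x)%:E].

Definition is_norm (R : realType) (N : R * R -> R) : Prop :=
  [/\ forall v, N v = 0 -> v = (0, 0),
      forall v w, N (v.1 + w.1, v.2 + w.2) <= N v + N w &
      forall (c : R) v, N (c * v.1, c * v.2) = `|c| * N v].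

Definition bounded_away (R : realType) (B : set (R * R)) : Prop :=
  ~ closure B ((0, 0) : R * R).

(* A measure on the punctured plane is represented by its extension to the
   plane giving no mass to the origin. *)
Definition radon_punctured (R : realType)
    (mu : {measure set (R * R) -> \bar R}) : Prop :=
  mu [set (0, 0)] = 0%E /\
  forall B : set (R * R), measurable B -> bounded_away B -> (mu B < +oo)%E.

(* Vague convergence on the punctured plane, the bounded sets being those
   bounded away from the origin: test functions are the nonnegative bounded
   continuous functions whose support is bounded away from the origin. The
   [nu n] may charge the origin, where every test function vanishes. *)
Definition vague_cvg_punctured (R : realType)
    (nu : nat -> set (R * R) -> \bar R)
    (mu : {measure set (R * R) -> \bar R}) : Prop :=
  forall g : R * R -> R,
    continuous g ->
    (forall v, 0 <= g v) ->
    (exists M : R, forall v, g v <= M) ->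
    bounded_away [set v | g v != 0] ->
    (\int[nu n]_v (g v)%:E)%E @[n --> \oo] --> (\int[mu]_v (g v)%:E)%E.

Definition scaled_law (d : measure_display) (T : measurableType d)
    (R : realType) (P : probability T R) (n : nat) (V : T -> R * R)
    (B : set (R * R)) : \bar R :=
  (n%:R%:E * P (V @^-1` B))%E.

Definition regularly_varying_vector (d : measure_display)
    (T : measurableType d) (R : realType) (P : probability T R)
    (V : T -> R * R) (alpha : R) : Prop :=
  exists N : R * R -> R,
    [/\ is_norm N,
        regularly_varying P (N \o V) alpha &
        exists (a : nat -> R) (mu : {measure set (R * R) -> \bar R}),
          [/\ (n%:R%:E * P [set w | (a n < N (V w))%R])%E @[n --> \oo] --> 1%:E,
              radon_punctured mu,
              mu [set: R * R] <> 0%E &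
              vague_cvg_punctured
                (fun n => scaled_law P n (fun w =>
                   ((a n)^-1 * (V w).1, (a n)^-1 * (V w).2))) mu]].

(* Restricted to measurable sets, since the value of a measure outside the
   sigma-algebra is arbitrary. *)
Definition eq_in_law (d1 d2 d : measure_display) (T1 : measurableType d1)
    (T2 : measurableType d2) (S : measurableType d) (R : realType)
    (P1 : probability T1 R) (P2 : probability T2 R)
    (X1 : T1 -> S) (X2 : T2 -> S) : Prop :=
  forall B : set S, measurable B -> P1 (X1 @^-1` B) = P2 (X2 @^-1` B).

Definition sigma_of (d d' : measure_display) (T : measurableType d)
    (S : measurableType d') (X : T -> S) : set (set T) :=
  preimage_set_system setT X measurable.

Definition sigma_of_seq (d d' : measure_display) (T : measurableType d)
    (S : measurableType d') (X : nat -> T -> S) : set (set T) :=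
  <<s \bigcup_j sigma_of (X j) >>.

Definition independent_sigma (d : measure_display) (T : measurableType d)
    (R : realType) (P : probability T R) (F G : set (set T)) : Prop :=
  forall A B, F A -> G B -> P (A `&` B) = (P A * P B)%E.

Definition independent_seq (d d' : measure_display) (T : measurableType d)
    (S : measurableType d') (R : realType) (P : probability T R)
    (X : nat -> T -> S) : Prop :=
  forall (J : {fset nat}) (B : nat -> set S),
    (forall j, measurable (B j)) ->
    P (\bigcap_(j in [set` J]) (X j @^-1` B j)) =
    (\prod_(j <- J) P (X j @^-1` B j))%E.

(* Main.v *)
Require Import Defs.
From HB Require Import structures.
From mathcomp Require Import all_boot all_order all_algebra finmap.
From mathcomp Require Import all_classical all_reals all_analysis.
From mathcomp Require Import measurable_realfun ring lra.
Import Order.TTheory GRing.Theory Num.Theory.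
Import numFieldNormedType.Exports.

(** The cluster sum [D = X + X_1 + ... + X_K] exceeds a high level in two ways:
    either the pair [(X, K)] is large, and the law of large numbers replaces the
    sum of the offspring marks by [m K] with [m = E X]; or [(X, K)] is moderate and
    exactly one of the [K] offspring marks is large. The two terms of the
    equivalence are the probabilities of these two scenarios.

    All tails are compared with [H x = P(N (X, K) > x)], where [N] is the norm that
    witnesses the regular variation of the pair. Vague convergence is used
    through a single consequence, [linear_tail_cvg]: the tail of a linear
    combination [u X + v K] with nonnegative coefficients, divided by [H], has a
    limit. Let [c1] be the limit for [X] and [cT] the limit for [X + m K], which
    is positive because [X + m K] dominates the norm up to a constant. The tail of
    [D] divided by [H] tends to [cT + E K * c1], by [compound_tail]. The
    right-hand side of the equivalence has the same limit, and regular variation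
    passes from [H] to any tail whose ratio to [H] has a positive limit.

    Write [S k] for the sum of [k] offspring marks. For fixed [k] its tail
    divided by [H] tends to [k c1] ([tail_partial_sum], by induction from the case
    of two independent summands, [tail_add_indep]). Summing over the values of [K] asks
    for a bound that is uniform in [k]: [partial_sum_large_dev] bounds
    [P(S k > m k + dl x)] by [C k H x] for all [k <= B x], through exponential
    moments of the marks truncated at a small multiple of [x]. As [K] has a
    finite mean, only finitely many [k] matter in the limit. This gives the
    upper bound [compound_upper]; the lower bound [compound_lower] uses the
    one-sided law of large numbers [lln_lower]. In both, the thresholds are
    moved by a factor [t] close to 1, which costs a factor [t^(- alpha)]. *)

Set Implicit Arguments.
Unset Strict Implicit.
Unset Printing Implicit Defensive.

Local Open Scope classical_set_scope.
Local Open Scope ring_scope.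

(** * Regularly varying tails *)

Section RegularVariation.
Context {R : realType}.
Implicit Types (H F : R -> R) (alpha t x c : R).

(** For a nonincreasing positive function, the pointwise limits alone give
    power bounds, through the values at [x0], [2 x0], [4 x0] and so on. *)
Definition rv_tail H alpha : Prop :=
  [/\ forall x y, x <= y -> H y <= H x,
      forall x, 0 < H x &
      forall t, 0 < t -> H (t * x) / H x @[x --> +oo] --> t `^ (- alpha)].

Lemma powRV t a : 0 < t -> (t^-1) `^ a = t `^ (- a).
Proof.
move=> t0; rewrite /powR invr_eq0 gt_eqF // lnV ?posrE //.
by rewrite mulrN mulNr.
Qed.

Lemma near_scale t (A : set R) : 0 < t ->
  (\forall x \near +oo, A x) -> \forall x \near +oo, A (t * x).
Proof.
move=> t0 [M [Mr AM]]; exists (M / t); split; first exact: num_real.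
by move=> x Mx; apply: AM; rewrite mulrC -ltr_pdivrMr.
Qed.

Lemma near_ge (M : R) : \forall x \near +oo, M <= x.
Proof. exact/nbhs_pinfty_ge/num_real. Qed.

Lemma near_gt (M : R) : \forall x \near +oo, M < x.
Proof. exact/nbhs_pinfty_gt/num_real. Qed.

Lemma cvg_scale (f : R -> R) (t l : R) : 0 < t ->
  f x @[x --> +oo] --> l -> f (t * x) @[x --> +oo] --> l.
Proof.
move=> t0 fl A /fl; rewrite /= !near_simpl => fA.
exact: (near_scale (A := fun x => A (f x))).
Qed.

Lemma rv_tail_scale_cvg H alpha F c t : rv_tail H alpha -> 0 < t ->
  F x / H x @[x --> +oo] --> c ->
  F (t * x) / H x @[x --> +oo] --> c * t `^ (- alpha).
Proof.
move=> [_ H0 HRV] t0 Fc.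
have -> : (fun x => F (t * x) / H x) =
    (fun x => (F (t * x) / H (t * x)) * (H (t * x) / H x)).
  apply/funext => x; rewrite mulrA divfK //.
  by rewrite gt_eqF.
by apply: cvgM; [exact: (cvg_scale (f := fun x => F x / H x)) | exact: HRV].
Qed.

Lemma rv_tail_doubling_le H alpha g : rv_tail H alpha -> g < alpha ->
  exists2 x0, 1 <= x0 & forall x, x0 <= x -> H (2 * x) <= 2 `^ (- g) * H x.
Proof.
move=> [_ H0 HRV] ga.
have l2 : (2 : R) `^ (- alpha) < 2 `^ (- g).
  rewrite !powRN ltf_pV2 ?posrE ?powR_gt0 //.
  by rewrite /powR pnatr_eq0 /= ltr_expR ltr_pM2r // ln_gt0 // ltr1n.
have h := HRV 2 (ltr0Sn _ 1).
have [M [_ hM]] := cvgr_lt _ h _ l2.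
exists (Num.max 1 (M + 1)); first by rewrite le_max lexx.
move=> x; rewrite ge_max => /andP[_ Mx].
rewrite -ler_pdivrMr //; apply/ltW/hM.
by apply: lt_le_trans Mx; rewrite ltrDl.
Qed.

Lemma rv_tail_doubling_ge H alpha g : rv_tail H alpha -> alpha < g ->
  exists2 x0, 1 <= x0 & forall x, x0 <= x -> 2 `^ (- g) * H x <= H (2 * x).
Proof.
move=> [_ H0 HRV] ga.
have l2 : (2 : R) `^ (- g) < 2 `^ (- alpha).
  rewrite !powRN ltf_pV2 ?posrE ?powR_gt0 //.
  by rewrite /powR pnatr_eq0 /= ltr_expR ltr_pM2r // ln_gt0 // ltr1n.
have h := HRV 2 (ltr0Sn _ 1).
have [M [_ hM]] := cvgr_gt _ h _ l2.
exists (Num.max 1 (M + 1)); first by rewrite le_max lexx.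
move=> x; rewrite ge_max => /andP[_ Mx].
rewrite -ler_pdivlMr //; apply/ltW/hM.
by apply: lt_le_trans Mx; rewrite ltrDl.
Qed.

Lemma dyadic_induction (x0 : R) (Q : R -> Prop) : 0 < x0 ->
  (forall x, x0 <= x <= 2 * x0 -> Q x) ->
  (forall x, x0 <= x -> Q x -> Q (2 * x)) ->
  forall x, x0 <= x -> Q x.
Proof.
move=> x00 Q0 Q2.
have QN n x : x0 <= x <= 2 ^+ n.+1 * x0 -> Q x.
  elim: n x => [|n IH] x; first by rewrite expr1; exact: Q0.
  move=> /andP[x0x xn]; have [xl|xg] := leP x (2 * x0).
    by apply: Q0; rewrite x0x.
  have -> : x = 2 * (x / 2) by rewrite mulrC divfK.
  apply: Q2; first by rewrite ler_pdivlMr // mulrC ltW.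
  apply: IH; rewrite ler_pdivlMr // mulrC (ltW xg) /=.
  by rewrite ler_pdivrMr // mulrAC -exprSr.
move=> x x0x; apply: (QN (Num.bound (x / x0))); rewrite x0x /=.
rewrite -ler_pdivrMr //.
have /ltW h : x / x0 < (Num.bound (x / x0))%:R.
  by apply: archi_boundP; rewrite divr_ge0 // ltW // (lt_le_trans x00).
apply: (le_trans h); rewrite -natrX ler_nat.
by rewrite ltnW // (ltn_trans (ltnSn _)) // ltn_expl.
Qed.

(** A Potter bound by doubling: [H (2 x) / H x] tends to [2^(-alpha)], which is
    less than [2^(-g)], so each doubling costs at least the factor [2^(-g)];
    monotonicity fills the gaps between consecutive doublings. *)
Lemma rv_tail_upper H alpha g : rv_tail H alpha -> 0 < g < alpha ->
  exists2 C, 0 < C & forall x, 1 <= x -> H x <= C * x `^ (- g).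
Proof.
move=> HH /andP[g0 ga].
have [x0 x01 h] := rv_tail_doubling_le HH ga.
have [Hm H0 _] := HH.
have x00 : 0 < x0 by apply: lt_le_trans x01.
pose C := H 1 * (2 * x0) `^ g.
have hC x : 1 <= x -> x <= 2 * x0 -> H x <= C * x `^ (- g).
  move=> x1 x2; apply: (le_trans (Hm _ _ x1)).
  rewrite /C -mulrA ler_peMr ?(ltW (H0 _)) //.
  rewrite powRN -ler_pdivrMr ?invr_gt0 ?powR_gt0 ?(lt_le_trans _ x1)//.
  rewrite invrK mul1r ge0_ler_powR ?nnegrE ?(ltW g0) ?mulr_ge0 ?(ltW x00) //.
  exact: le_trans x1.
exists C; first by rewrite mulr_gt0 // powR_gt0 // mulr_gt0.
move=> x x1; have [xx0|/ltW xx0] := leP x (2 * x0); first exact: hC.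
apply: (@dyadic_induction x0 (fun x => H x <= C * x `^ (- g))) => //.
- by move=> y /andP[y1 y2]; apply: hC => //; exact: le_trans y1.
- move=> y y1 Hy; apply: (le_trans (h _ y1)).
  rewrite powRM // ?(le_trans (ltW x00)) // mulrCA.
  by rewrite ler_wpM2l ?powR_ge0.
- by apply: le_trans xx0; rewrite ler_peMl ?(ltW x00) // ler1n.
Qed.

(** The same doubling argument from below. A power decay faster than the index
    is therefore negligible with respect to [H], which is how the exponential
    estimates on truncated sums are absorbed. *)
Lemma rv_tail_lower H alpha g : rv_tail H alpha -> 0 < alpha < g ->
  exists2 c, 0 < c & \forall x \near +oo, c * x `^ (- g) <= H x.
Proof.
move=> HH /andP[a0 ag].
have [x0 x01 h] := rv_tail_doubling_ge HH ag.
have [Hm H0 _] := HH.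
have x00 : 0 < x0 by apply: lt_le_trans x01.
pose c := H (2 * x0) * x0 `^ g.
exists c; first by rewrite mulr_gt0 // powR_gt0.
near=> x; have xx0 : x0 <= x by near: x; exact: near_ge.
move: xx0; apply: (@dyadic_induction x0 (fun x => c * x `^ (- g) <= H x)) => //.
- move=> y /andP[y1 y2]; apply: le_trans (Hm _ _ y2).
  rewrite /c -mulrA ler_piMr ?(ltW (H0 _)) // powRN.
  rewrite ler_pdivrMr ?powR_gt0 ?(lt_le_trans x00) // mul1r.
  by rewrite ge0_ler_powR ?nnegrE ?(ltW x00) ?(le_trans _ y1) // ltW // (lt_trans a0).
- move=> y y1 Hy; apply: le_trans (h _ y1).
  rewrite powRM // ?(le_trans (ltW x00)) // mulrCA.
  by rewrite ler_wpM2l ?powR_ge0.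
Unshelve. all: by end_near. Qed.

Lemma rv_tail_cvg0 H alpha : rv_tail H alpha -> 0 < alpha ->
  H x @[x --> +oo] --> 0.
Proof.
move=> HH a0; have [Hm H0 _] := HH.
have [|C C0 hC] := @rv_tail_upper H alpha (alpha / 2) HH.
  by rewrite divr_gt0 //= ltr_pdivrMr // ltr_pMr // ltr1n.
apply/cvgrPdist_le => e e0; near=> x.
rewrite sub0r normrN gtr0_norm //.
have x1 : 1 <= x by near: x; exact: near_ge.
apply: (le_trans (hC _ x1)).
suff h : x `^ (- (alpha / 2)) <= e / C by rewrite mulrC -ler_pdivlMr.
rewrite powRN -[leRHS]invrK lef_pV2 ?posrE ?invr_gt0 ?divr_gt0 ?powR_gt0 ?(lt_le_trans _ x1) //.
have -> : (e / C)^-1 = (e / C)^-1 `^ (2 / alpha) `^ (alpha / 2).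
  rewrite -powRrM (_ : 2 / alpha * (alpha / 2) = 1); last by field; rewrite gt_eqF.
  by rewrite powRr1 // invr_ge0 divr_ge0 ?ltW.
have xe : (e / C)^-1 `^ (2 / alpha) <= x by near: x; exact: near_ge.
apply: ge0_ler_powR => //; rewrite ?nnegrE ?powR_ge0 ?divr_ge0 ?(ltW a0) //.
Unshelve. all: by end_near. Qed.

Lemma near_le_of_cvg (F H : R -> R) c b : (forall x, 0 < H x) ->
  F x / H x @[x --> +oo] --> c -> c < b -> \forall x \near +oo, F x <= b * H x.
Proof.
move=> H0 Fc cb; near=> x; rewrite -ler_pdivrMr //; apply/ltW.
by near: x; exact: cvgr_lt Fc _ cb.
Unshelve. all: by end_near. Qed.

Lemma near_ge_of_cvg (F H : R -> R) c b : (forall x, 0 < H x) ->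
  F x / H x @[x --> +oo] --> c -> b < c -> \forall x \near +oo, b * H x <= F x.
Proof.
move=> H0 Fc cb; near=> x; rewrite -ler_pdivlMr //; apply/ltW.
by near: x; exact: cvgr_gt Fc _ cb.
Unshelve. all: by end_near. Qed.

Lemma cvg_of_near_bounds (F H : R -> R) c : (forall x, 0 < H x) ->
  (forall e, 0 < e -> \forall x \near +oo, F x <= (c + e) * H x) ->
  (forall e, 0 < e -> \forall x \near +oo, (c - e) * H x <= F x) ->
  F x / H x @[x --> +oo] --> c.
Proof.
move=> H0 hu hl; apply/cvgrPdist_le => e e0; near=> x.
rewrite distrC ler_distl ler_pdivrMr // ler_pdivlMr //; apply/andP; split.
  by near: x; exact: hl.
by near: x; exact: hu.
Unshelve. all: by end_near. Qed.

Lemma rv_tail_equiv H alpha F c : rv_tail H alpha ->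
  (forall x y, x <= y -> F y <= F x) -> 0 < c ->
  F x / H x @[x --> +oo] --> c -> rv_tail F alpha.
Proof.
move=> HH Fm c0 Fc; have [Hm H0 HRV] := HH.
have F0 x : 0 < F x.
  have [M [_ hM]] := cvgr_gt _ Fc _ c0.
  have xM : Num.max x (M + 1) > M by rewrite lt_max ltrDl ltr01 orbT.
  have := hM _ xM; rewrite pmulr_lgt0 ?invr_gt0 // => /lt_le_trans; apply.
  by apply: Fm; rewrite le_max lexx.
split=> // t t0.
have -> : (fun x => F (t * x) / F x) = (fun x => (F (t * x) / H x) / (F x / H x)).
  apply/funext => x; rewrite invf_div mulrA divfK // gt_eqF //.
have -> : t `^ (- alpha) = c * t `^ (- alpha) / c by rewrite mulrAC mulfV ?mul1r // gt_eqF.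
apply: cvgM; first exact: rv_tail_scale_cvg HH t0 Fc.
by apply: cvgV => //; rewrite gt_eqF.
Qed.

End RegularVariation.

(** * Probabilities and tails *)

Section ProbabilityBasics.
Context d (T : measurableType d) (R : realType) (P : probability T R).
Implicit Types (A B : set T) (Z W : T -> R).

(** Probabilities as real numbers, so that quotients and limits are taken in
    [R] rather than in the extended line. *)
Definition pr A : R := fine (P A).
Definition tail Z x : R := pr [set w | x < Z w].

Lemma pr_EFin A : measurable A -> (pr A)%:E = P A.
Proof. by move=> mA; rewrite /pr fineK // fin_num_measure. Qed.

Lemma pr_ge0 A : 0 <= pr A.
Proof. by rewrite /pr fine_ge0. Qed.

Lemma le_pr A B : measurable A -> measurable B -> A `<=` B -> pr A <= pr B.
Proof.
move=> mA mB AB; rewrite -lee_fin !pr_EFin //.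
by apply: le_measure; rewrite ?inE.
Qed.

Lemma pr_setU A B : measurable A -> measurable B ->
  pr (A `|` B) <= pr A + pr B.
Proof.
move=> mA mB; rewrite -lee_fin EFinD !pr_EFin //; last exact: measurableU.
exact: measureU2.
Qed.

Lemma le_pr_setU A B C : measurable A -> measurable B -> measurable C ->
  A `<=` B `|` C -> pr A <= pr B + pr C.
Proof.
move=> mA mB mC ABC; apply: le_trans (pr_setU mB mC).
by apply: le_pr => //; exact: measurableU.
Qed.

Lemma le_pr_sum A (F : nat -> set T) n : measurable A ->
  (forall k, measurable (F k)) -> A `<=` \big[setU/set0]_(k < n) F k ->
  pr A <= \sum_(k < n) pr (F k).
Proof.
move=> mA mF AF; have mU : measurable (\big[setU/set0]_(k < n) F k).
  by apply: bigsetU_measurable => k _.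
apply: le_trans (le_pr mA mU AF) _.
rewrite -lee_fin pr_EFin // -sumEFin.
apply: le_trans (Boole_inequality _ _) _ => //.
by apply: lee_sum => k _; rewrite pr_EFin.
Qed.

Lemma ge_pr_sum A (F : nat -> set T) n : measurable A ->
  (forall k, measurable (F k)) -> trivIset setT F ->
  (forall k, F k `<=` A) -> \sum_(k < n) pr (F k) <= pr A.
Proof.
move=> mA mF tF FA; have mU : measurable (\big[setU/set0]_(k < n) F k).
  by apply: bigsetU_measurable => k _.
apply: le_trans (le_pr mU mA _); last first.
  by rewrite -bigcup_mkord; apply: bigcup_sub => k _.
rewrite -lee_fin pr_EFin // measure_bigsetU // -sumEFin.
by apply: lee_sum => k _; rewrite pr_EFin.
Qed.

Lemma gt_setE Z x : [set w | x < Z w] = Z @^-1` `]x, +oo[%classic.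
Proof. by apply/seteqP; split => w /=; rewrite in_itv /= andbT. Qed.

Lemma measurable_gtr Z x : measurable_fun setT Z -> measurable [set w | x < Z w].
Proof.
move=> mZ; rewrite -[X in measurable X]setTI gt_setE.
by apply: mZ => //; exact: measurable_itv.
Qed.

Lemma measurable_ler Z x : measurable_fun setT Z -> measurable [set w | Z w <= x].
Proof.
move=> mZ; have -> : [set w | Z w <= x] = ~` [set w | x < Z w].
  by apply/seteqP; split => w /=; rewrite leNgt => /negP.
by apply: measurableC; exact: measurable_gtr.
Qed.

Lemma measurable_ltr Z x : measurable_fun setT Z -> measurable [set w | Z w < x].
Proof.
move=> mZ; rewrite -[X in measurable X]setTI.
have -> : [set w | Z w < x] = Z @^-1` `]-oo, x[%classic.
  by apply/seteqP; split => w /=; rewrite in_itv /=.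
by apply: mZ => //; exact: measurable_itv.
Qed.

Lemma measurable_ger Z x : measurable_fun setT Z -> measurable [set w | x <= Z w].
Proof.
move=> mZ; have -> : [set w | x <= Z w] = ~` [set w | Z w < x].
  by apply/seteqP; split => w /=; rewrite leNgt => /negP.
by apply: measurableC; exact: measurable_ltr.
Qed.

Lemma tail_nincr Z : measurable_fun setT Z ->
  forall x y, x <= y -> tail Z y <= tail Z x.
Proof.
move=> mZ x y xy; apply: le_pr; try exact: measurable_gtr.
by move=> w /=; exact: le_lt_trans.
Qed.

Lemma le_tail Z W x y : measurable_fun setT Z -> measurable_fun setT W ->
  (forall w, x < Z w -> y < W w) -> tail Z x <= tail W y.
Proof. by move=> mZ mW ZW; apply: le_pr => //; exact: measurable_gtr. Qed.

Lemma integral_one : (\int[P]_w (1 : \bar R) = 1)%E.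
Proof. by rewrite (integral_cst P measurableT 1%E) mul1e; exact: probability_setT. Qed.

Lemma markov_pr Z a (r : R) : measurable_fun setT Z -> (forall w, 0 <= Z w) ->
  0 < a -> (\int[P]_w (Z w)%:E <= r%:E)%E -> pr [set w | a <= Z w] <= r / a.
Proof.
move=> mZ Z0 a0 ir.
have mA : measurable [set w | a <= Z w] by exact: measurable_ger.
rewrite ler_pdivlMr // mulrC -lee_fin EFinM pr_EFin //; apply: le_trans ir.
rewrite -[X in (_ * P X)%E]setIT -integral_indic // -ge0_integralZl_EFin //; last 2 first.
  by apply/measurable_EFinP; exact: measurable_indic.
  exact: ltW.
apply: ge0_le_integral => //.
- by move=> w _; rewrite mule_ge0 // lee_fin ltW.
- by apply/measurable_EFinP/measurable_funM => //; exact: measurable_indic.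
- exact/measurable_EFinP.
- move=> w _; rewrite -EFinM lee_fin indicE.
  by case: (boolP (w \in _)) => [|_]; rewrite /= ?mulr0 // inE mulr1.
Qed.

End ProbabilityBasics.

(** * Moments *)

Section Moments.
Context d (T : measurableType d) (R : realType) (P : probability T R).
Implicit Types (Z : T -> R).

Lemma dyadic_bracket (z : R) : 1 < z -> exists n : nat, 2 ^+ n < z <= 2 ^+ n.+1.
Proof.
move=> z1.
have ex : exists n, z <= 2 ^+ n.+1.
  exists (Num.bound z); apply: ltW.
  apply: (lt_le_trans (archi_boundP _)); first by rewrite ltW // (lt_trans ltr01).
  rewrite -natrX ler_nat ltnW // (ltn_trans (ltnSn _)) //.
  exact: ltn_expl.
case: (ex_minnP ex) => n zn nmin; exists n; rewrite zn andbT.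
case: n zn nmin => [|n] zn nmin; first by rewrite expr0.
by rewrite ltNge; apply/negP => /nmin; rewrite ltnn.
Qed.

(** A dyadic step function dominates the power, and a tail of exponent [g > b]
    bounds its integral by a geometric series. *)
Lemma moment_of_tail Z C b g : measurable_fun setT Z -> (forall w, 0 <= Z w) ->
  0 < b < g -> (forall x, 1 <= x -> tail P Z x <= C * x `^ (- g)) ->
  (\int[P]_w (Z w `^ b)%:E < +oo)%E.
Proof.
move=> mZ Z0 /andP[b0 bg] hC.
have C0 : 0 <= C.
  by have := le_trans (pr_ge0 _ _) (hC 1 (lexx _)); rewrite powR1 mulr1.
pose f n w : \bar R := ((2 ^+ n.+1) `^ b * \1_[set w | 2 ^+ n < Z w] w)%:E.
have f0 n w : (0 <= f n w)%E by rewrite lee_fin mulr_ge0 // powR_ge0.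
have mf n : measurable_fun setT (f n).
  apply/measurable_EFinP/measurable_funM => //.
  exact/measurable_indic/measurable_gtr.
apply: (@le_lt_trans _ _ (\int[P]_w (1 + \sum_(0 <= n <oo) f n w))%E).
  apply: ge0_le_integral => //.
  - by move=> w _; rewrite lee_fin powR_ge0.
  - by apply/measurable_EFinP; exact: (measurableT_comp (measurable_powR b)).
  - by apply: emeasurable_funD => //; exact: ge0_emeasurable_sum.
  - move=> w _; have [Z1|Z1] := leP (Z w) 1.
      apply: (@le_trans _ _ 1%E); last by rewrite leeDl // nneseries_ge0.
      have -> : 1%E = (1 `^ b)%:E :> \bar R by rewrite powR1.
      by rewrite lee_fin ge0_ler_powR ?nnegrE // ltW.
    have [n /andP[nZ Zn]] := dyadic_bracket Z1.
    apply: (@le_trans _ _ (f n w)).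
      rewrite /f indicE mem_set // mulr1 lee_fin.
      by rewrite ge0_ler_powR ?nnegrE ?exprn_ge0 // ltW.
    apply: le_trans (leeDr _ _) => //.
    apply: le_trans (nneseries_lim_ge n.+1 _) => //.
    by rewrite big_nat_recr //= leeDr // sume_ge0.
rewrite ge0_integralD //; last 2 first.
  by move=> w _; rewrite nneseries_ge0.
  exact: ge0_emeasurable_sum.
rewrite integral_one.
rewrite integral_nneseries //.
pose q : R := 2 `^ (b - g).
have q01 : 0 <= q < 1.
  rewrite powR_ge0 /= /q /powR pnatr_eq0 /= -[ltRHS]expR0 ltr_expR.
  by rewrite pmulr_llt0 ?subr_lt0 // ln_gt0 // ltr1n.
have fle n : (\int[P]_w f n w <= (geometric (C * 2 `^ b) q n)%:E)%E.
  have -> : (\int[P]_w f n w = ((2 ^+ n.+1) `^ b * tail P Z (2 ^+ n))%:E)%E.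
    under eq_integral do rewrite /f EFinM.
    rewrite ge0_integralZl_EFin ?powR_ge0 //; last first.
      by apply/measurable_EFinP/measurable_indic/measurable_gtr.
    rewrite integral_indic //; last exact: measurable_gtr.
    by rewrite setIT EFinM pr_EFin //; exact: measurable_gtr.
  rewrite lee_fin /geometric /=.
  have h : tail P Z (2 ^+ n) <= C * (2 ^+ n) `^ (- g).
    by apply: hC; rewrite exprn_ege1 // ler1n.
  apply: (le_trans (ler_wpM2l (powR_ge0 _ _) h)).
  have E2 (k : nat) (a : R) : (2 ^+ k) `^ a = (2 `^ a) ^+ k :> R.
    by rewrite -!powR_mulrn ?powR_ge0 // powRAC.
  rewrite !E2 exprSr /q powRD ?pnatr_eq0 ?implybT // exprMn.
  by rewrite le_eqVlt; apply/orP; left; apply/eqP; ring.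
rewrite -ge0_fin_numE; last by rewrite adde_ge0 // nneseries_ge0 // => n _ _; rewrite integral_ge0.
rewrite fin_numD /= ge0_fin_numE; last by rewrite nneseries_ge0 // => n _ _; rewrite integral_ge0.
apply: (@le_lt_trans _ _ (\sum_(0 <= n <oo) (geometric (C * 2 `^ b) q n)%:E)%E).
  by apply: lee_nneseries => // n _ _; rewrite integral_ge0.
have -> : (\sum_(0 <= n <oo) (geometric (C * 2 `^ b) q n)%:E)%E =
    (C * 2 `^ b / (1 - q))%:E.
  apply/cvg_lim => //.
  under eq_cvg do rewrite sumEFin.
  apply: cvg_EFin; first by near=> n.
  apply: cvg_geometric_series; rewrite ger0_norm; by case/andP: q01.
exact: ltry.
Unshelve. all: by end_near. Qed.

(** Monotone convergence for [K] set to 0 where it is at least [n]. *)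
Lemma cvg_partial_mean (K : T -> nat) : measurable_fun setT K ->
  (\int[P]_w ((K w)%:R%:E : \bar R) < +oo)%E ->
  \sum_(k < n) k%:R * pr P [set w | K w = k] @[n --> \oo] -->
    fine (\int[P]_w ((K w)%:R%:E : \bar R))%E.
Proof.
move=> mK Koo.
have mKk k : measurable [set w | K w = k].
  by rewrite -[X in measurable X]setTI; exact: (mK _ [set k]).
pose g n w : \bar R := (\sum_(k < n) k%:R * \1_[set w | K w = k] w)%:E.
have gE n w : g n w = (if (K w < n)%N then (K w)%:R else 0)%:E.
  congr EFin; case: ifPn => [Kn|Kn].
    rewrite (bigD1 (Ordinal Kn)) //= big1 ?addr0 => [|k kK].
      by rewrite indicE mem_set // mulr1.
    rewrite indicE memNset ?mulr0 // => /= Kk.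
    by move/eqP: kK; apply; apply/val_inj.
  rewrite big1 // => k _; rewrite indicE memNset ?mulr0 // => /= Kk.
  by move: Kn; rewrite Kk ltn_ord.
have mg n : measurable_fun setT (g n).
  apply/measurable_EFinP; apply: measurable_sum => k.
  by apply: measurable_funM => //; exact: measurable_indic.
have g0 n w : (0 <= g n w)%E by rewrite gE; case: ifP.
have glim w : limn (g ^~ w) = (K w)%:R%:E.
  apply/cvg_lim => //; apply: cvg_near_cst.
  by exists (K w).+1 => // n /= Kn; rewrite gE Kn.
have := @cvg_monotone_convergence _ _ _ P setT measurableT g mg (fun n w _ => g0 n w).
have -> : (\int[P]_w limn (g ^~ w) = \int[P]_w (K w)%:R%:E)%E.
  by apply: eq_integral => w _; rewrite glim.
have gi n : (\int[P]_w g n w)%E = (\sum_(k < n) k%:R * pr P [set w | K w = k])%:E.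
  rewrite -sumEFin; under eq_integral do rewrite /g -sumEFin.
  rewrite ge0_integral_sum //; last first.
    by move=> k; apply/measurable_EFinP/measurable_funM => //; exact: measurable_indic.
  apply: eq_bigr => k _; under eq_integral do rewrite EFinM.
  rewrite ge0_integralZl_EFin //; last exact/measurable_EFinP/measurable_indic.
  by rewrite integral_indic // setIT EFinM pr_EFin.
under eq_cvg do rewrite gi.
move=> h; suff : (\sum_(k < n) k%:R * pr P [set w | K w = k])%:E @[n --> \oo] -->
    (fine (\int[P]_w ((K w)%:R%:E : \bar R))%E)%:E by move/fine_cvg.
rewrite fineK; last by rewrite ge0_fin_numE // integral_ge0.
apply: h => w _ n m nm; rewrite !gE lee_fin.
case: ifP => [Kn|]; first by rewrite (leq_trans Kn nm).
by case: ifP.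
Qed.

End Moments.

(** * Independence *)

Section Independence.
Context d (T : measurableType d) (R : realType) (P : probability T R).

(** The pi-lambda theorem: for a fixed event of [F], the events that satisfy
    the product rule form a lambda-system. *)
Lemma independent_sigma_gen (G F : set (set T)) :
  G `<=` measurable -> F `<=` measurable -> setI_closed G ->
  independent_sigma P G F -> independent_sigma P <<s G >> F.
Proof.
move=> Gm Fm GI indGF A B GA FB.
have mB : measurable B by exact: Fm.
pose H := [set C | measurable C /\ P (C `&` B) = (P C * P B)%E].
have Pfin C : measurable C -> P C \is a fin_num by move=> mC; exact: fin_num_measure.
suff : <<s G >> `<=` H by move=> /(_ _ GA) [].
apply: lambda_system_subset => //.
- split=> //.
  + split; first exact: measurableT.
    by rewrite setTI [X in (X * _)%E]probability_setT mul1e.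
  + move=> C D DC [mC PC] [mD PD]; split; first exact: measurableD.
    rewrite setIDAC setIDA [LHS]measureD //;
      [|exact: measurableI|by rewrite -ge0_fin_numE // Pfin //; exact: measurableI].
    rewrite [P (C `\` D)]measureD // -?ge0_fin_numE // ?Pfin //.
    have -> : C `&` B `&` D = D `&` B by rewrite setIAC (setIidr DC).
    rewrite (setIidr DC) muleBl ?fin_num_adde_defr ?Pfin //.
    by congr (_ - _)%E; [exact: PC | exact: PD].
  + move=> C ndC HC; have mC i : measurable (C i) by case: (HC i).
    have mU : measurable (\bigcup_i C i) by exact: bigcup_measurable.
    split; first exact: mU.
    have c1 : P (C n `&` B) @[n --> \oo] --> P (\bigcup_i C i `&` B).
      rewrite setI_bigcupl; apply: nondecreasing_cvg_mu => //.
      - by move=> i; exact: measurableI.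
      - by apply: bigcup_measurable => i _; exact: measurableI.
      - by move=> n m nm; apply/subsetPset; apply: setSI; apply/subsetPset; exact: ndC.
    have c2 : (P (C n) * P B)%E @[n --> \oo] --> (P (\bigcup_i C i) * P B)%E.
      by apply: cvgeZr; [exact: Pfin | exact: nondecreasing_cvg_mu].
    have CE : (fun n => P (C n `&` B)) = (fun n => (P (C n) * P B)%E).
      by apply/funext => n; case: (HC n).
    by rewrite CE in c1; exact: (cvg_unique _ c1 c2).
- by move=> C GC; split; [exact: Gm | exact: indGF].
Qed.

Definition indep2 d1 d2 (S1 : measurableType d1) (S2 : measurableType d2)
    (U : T -> S1) (V : T -> S2) : Prop :=
  forall A B, measurable A -> measurable B ->
    P (U @^-1` A `&` V @^-1` B) = (P (U @^-1` A) * P (V @^-1` B))%E.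

(** The joint law is the product of the marginal laws, and Tonelli's theorem
    factors the integral. The absolute values in the proof make the integrand
    nonnegative on the whole plane. *)
Lemma integral_mul_indep (U V : T -> R) : measurable_fun setT U ->
  measurable_fun setT V -> (forall w, 0 <= U w) -> (forall w, 0 <= V w) ->
  indep2 U V ->
  (\int[P]_w (U w * V w)%:E = \int[P]_w (U w)%:E * \int[P]_w (V w)%:E)%E.
Proof.
move=> mU mV U0 V0 indUV.
pose U' : {RV P >-> R} := HB.pack_for {RV P >-> R} U (isMeasurableFun.Build _ _ _ _ _ mU).
pose V' : {RV P >-> R} := HB.pack_for {RV P >-> R} V (isMeasurableFun.Build _ _ _ _ _ mV).
have mUV : measurable_fun setT (fun w => (U w, V w)) by exact: measurable_fun_pair.
pose UV' : {RV P >-> (R * R)%type} :=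
  HB.pack_for {RV P >-> (R * R)%type} (fun w => (U w, V w)) (isMeasurableFun.Build _ _ _ _ _ mUV).
pose f (z : R * R) := (`|z.1| * `|z.2|)%:E.
have f0 z : (0 <= f z)%E by rewrite lee_fin mulr_ge0.
have mabs : measurable_fun [set: R] (fun y : R => `|y|%:E).
  by apply/measurable_EFinP; exact: normr_measurable.
have mf : measurable_fun setT f.
  by apply/measurable_EFinP/measurable_funM; apply: measurableT_comp.
transitivity (\int[distribution P UV']_z f z)%E.
  rewrite ge0_integral_distribution //; apply: eq_integral => w _ /=.
  by rewrite /f /= !ger0_norm.
transitivity (\int[distribution P U' \x distribution P V']_z f z)%E.
  apply: eq_measure_integral => A mA _; apply/esym.
  exact: product_measure_unique.
rewrite fubini_tonelli1 //.
have nU : (\int[distribution P U']_x `|x|%:E = \int[P]_w (U w)%:E)%E.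
  rewrite ge0_integral_distribution //.
  by apply: eq_integral => w _ /=; rewrite ger0_norm.
have nV : (\int[distribution P V']_x `|x|%:E = \int[P]_w (V w)%:E)%E.
  rewrite ge0_integral_distribution //.
  by apply: eq_integral => w _ /=; rewrite ger0_norm.
rewrite -nU -nV -ge0_integralZr //; last by apply: integral_ge0 => x _; rewrite lee_fin.
apply: eq_integral => x _; rewrite /fubini_F /f /=.
under eq_integral do rewrite EFinM.
by rewrite ge0_integralZl_EFin.
Qed.

Section Sequence.
Context (X : nat -> {RV P >-> R}) (hindep : independent_seq P X).

(** A pi-system that generates the sigma-algebra of the first [k] variables. *)
Definition past_cylinders k : set (set T) :=
  [set A | exists2 B : nat -> set R, (forall j, measurable (B j)) &
     A = \bigcap_(j in `I_k) (X j @^-1` B j)].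

Lemma prob_cylinder k (B : nat -> set R) : (forall j, measurable (B j)) ->
  P (\bigcap_(j in `I_k) (X j @^-1` B j)) =
  (\prod_(0 <= j < k) P (X j @^-1` B j))%E.
Proof.
move=> mB; pose J := [fset j | j in iota 0 k]%fset.
have JE : [set` J] = `I_k.
  by apply/seteqP; split => j /=; rewrite !inE /= mem_iota.
rewrite -JE hindep //; apply: perm_big; apply: uniq_perm.
- exact: fset_uniq.
- exact: iota_uniq.
- by move=> j; rewrite !inE /= /index_iota subn0.
Qed.

Lemma past_cylinders_indep k :
  independent_sigma P (past_cylinders k) (sigma_of (X k)).
Proof.
move=> A C [B mB ->] [D mD <-]; rewrite setTI.
pose B' j := if j == k then D else B j.
have mB' j : measurable (B' j) by rewrite /B'; case: ifP.
have -> : \bigcap_(j in `I_k) (X j @^-1` B j) `&` X k @^-1` D =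
    \bigcap_(j in `I_k.+1) (X j @^-1` B' j).
  apply/seteqP; split => w /=.
    move=> [hB hD] j /=; rewrite ltnS leq_eqVlt /B' => /orP[/eqP -> |jk].
      by rewrite eqxx.
    by rewrite (ltn_eqF jk); exact: hB.
  move=> h; split=> [j /= jk|]; last by have := h k (ltnSn k); rewrite /B' /= eqxx.
  by have := h j (ltnW jk); rewrite /B' /= (ltn_eqF jk).
rewrite !prob_cylinder // big_nat_recr //= {2}/B' eqxx; congr (_ * _)%E.
by rewrite !big_nat; apply: eq_bigr => j /andP[_ jk]; rewrite /B' (ltn_eqF jk).
Qed.

Lemma partial_sum_past k (phi : R -> R) : measurable_fun setT phi ->
  forall B, measurable B ->
  <<s past_cylinders k >> ((fun w => \sum_(j < k) phi (X j w)) @^-1` B).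
Proof.
move=> mphi B mB.
have : measurable_fun setT
    (fun w : g_sigma_algebraType (past_cylinders k) => \sum_(j < k) phi (X j w)).
  apply: measurable_sum => j; apply: (measurableT_comp mphi) => _ Y mY.
  rewrite setTI; apply: sub_sigma_algebra.
  exists (fun i => if i == j :> nat then Y else setT); first by move=> i; case: ifP.
  apply/seteqP; split => w /= hw.
    by move=> i _; case: eqP => [->|].
  by have := hw j (ltn_ord j); rewrite /= eqxx.
by move=> /(_ measurableT _ mB); rewrite setTI.
Qed.

Lemma partial_sum_indep k (phi : R -> R) : measurable_fun setT phi ->
  indep2 (fun w => \sum_(j < k) phi (X j w)) (X k).
Proof.
move=> mphi A B mA mB.
apply: (@independent_sigma_gen (past_cylinders k) (sigma_of (X k))).
- move=> _ [C mC ->]; apply: bigcap_measurableType => j _.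
  exact: measurable_funPTI.
- by move=> _ [C mC <-]; rewrite setTI; exact: measurable_funPTI.
- move=> _ _ [C mC ->] [D mD ->]; exists (fun j => C j `&` D j).
    by move=> j; exact: measurableI.
  by rewrite -bigcapI.
- exact: past_cylinders_indep.
- exact: partial_sum_past.
- by exists B => //; rewrite setTI.
Qed.

Lemma partial_sum_sigma_seq k :
  forall B, measurable B -> sigma_of_seq X ((fun w => \sum_(j < k) X j w) @^-1` B).
Proof.
move=> B mB.
have : measurable_fun setT (fun w : g_sigma_algebraType (\bigcup_j sigma_of (X j)) =>
    \sum_(j < k) X j w).
  apply: measurable_sum => j _ Y mY.
  apply: sub_sigma_algebra; exists (j : nat) => //.
  by exists Y.
by move=> /(_ measurableT _ mB); rewrite setTI.
Qed.

Lemma integral_expR_sum_le k (phi : R -> R) (r : R) : measurable_fun setT phi ->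
  (forall j, (\int[P]_w (expR (phi (X j w)))%:E <= r%:E)%E) ->
  (\int[P]_w (expR (\sum_(j < k) phi (X j w)))%:E <= (r ^+ k)%:E)%E.
Proof.
move=> mphi hr.
have mexp : measurable_fun setT (@expR R) by exact: measurable_expR.
have mS n : measurable_fun setT (fun w => \sum_(j < n) phi (X j w)).
  by apply: measurable_sum => j; apply: (measurableT_comp mphi).
elim: k => [|k IH].
  under eq_integral do rewrite big_ord0 expR0.
  by rewrite integral_one expr0.
under eq_integral do rewrite big_ord_recr /= expRD.
rewrite integral_mul_indep; last 5 first.
- exact: (measurableT_comp mexp (mS k)).
- exact: (measurableT_comp mexp (measurableT_comp mphi _)).
- by move=> w; exact: expR_ge0.
- by move=> w; exact: expR_ge0.
- move=> A B mA mB; rewrite -[_ @^-1` A]/((fun w => \sum_(j < k) phi (X j w)) @^-1` (expR @^-1` A)).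
  rewrite -[_ @^-1` B]/(X k @^-1` ((expR \o phi) @^-1` B)).
  apply: partial_sum_indep => //.
    by rewrite -[X in measurable X]setTI; exact: mexp.
  by rewrite -[X in measurable X]setTI; exact: (measurableT_comp mexp mphi).
by rewrite exprSr EFinM lee_pmul // integral_ge0 // => w _; rewrite lee_fin expR_ge0.
Qed.

End Sequence.
End Independence.

(** * Exponential inequalities *)

Section ElementaryInequalities.
Context {R : realType}.
Implicit Types (a c e t u w y b : R).

(** Continuity of [t^(-a)] at 1, in the form that chooses the loss allowed
    between the thresholds [x] and [t x]. *)
Lemma powR_scale_lt a c e : 0 < a -> 0 <= c -> 0 < e ->
  exists t, 0 < t < 1 /\ c * t `^ (- a) < c + e.
Proof.
move=> a0 c0 e0; have c1 : 0 < c + 1 by rewrite ltr_wpDl.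
pose y := 1 + e / (c + 1).
have y1 : 1 < y by rewrite ltrDl divr_gt0.
have y0 : 0 < y by apply: lt_trans y1.
exists (y `^ (- a^-1)); split.
  rewrite powR_gt0 //= powRN invf_lt1 ?powR_gt0 //.
  by rewrite -[X in X < _](powRr0 y) /powR gt_eqF // ltr_expR mul0r mulr_gt0 ?invr_gt0 ?ln_gt0.
rewrite -powRrM mulrNN mulVf ?gt_eqF // powRr1 ?ltW // /y mulrDr mulr1 ltrD2l.
by rewrite mulrA ltr_pdivrMr // mulrDr mulr1 mulrC ltrDl.
Qed.

Lemma expR_le_quadratic u : 0 <= u -> expR u <= 1 + u + u ^+ 2 * expR u.
Proof.
move=> u0; have eu := expR_gt0 u.
have [u1|u1] := leP 1 u.
  apply: (@le_trans _ _ (u ^+ 2 * expR u)); last by rewrite lerDr addr_ge0.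
  by rewrite ler_peMl ?(ltW eu) // exprn_ege1.
have h : (1 - u) * expR u <= 1.
  have := expR_ge1Dx (- u); rewrite -(ler_pM2r eu) expRN mulVf ?gt_eqF //.
have h2 : (1 - u) * expR u * (1 + u) <= 1 * (1 + u).
  by rewrite ler_pM2r // ltr_wpDr.
rewrite -lerBlDr; apply: le_trans _ (le_trans h2 _); last by rewrite mul1r.
by rewrite le_eqVlt; apply/orP; left; apply/eqP; ring.
Qed.

(** Put [u = s min(y, t)] and [w = s t]. The remainder [u^2 e^u] is at most
    [(u / w)^b w^2 e^w] because [u <= w] and [b <= 2], and [w^2 <= 2 e^w]. The
    mean of the right-hand side involves only a moment of order [b], which may
    be finite when the variance is not. *)
Lemma expR_truncated_le b t s y : 0 < b <= 2 -> 0 < t -> 0 <= s -> 0 <= y ->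
  expR (s * Num.min y t) <=
  1 + s * y + 2 * expR (2 * (s * t)) * (t `^ (- b) * y `^ b).
Proof.
move=> /andP[b0 b2] t0 s0 y0; set z := Num.min y t.
have z0 : 0 <= z by rewrite le_min y0 ltW.
have zy : z <= y by rewrite ge_min lexx.
have zt : z <= t by rewrite ge_min lexx orbT.
apply: (le_trans (expR_le_quadratic (mulr_ge0 s0 z0))).
apply: lerD; first by rewrite lerD2l ler_wpM2l.
have -> : s * z = s * t * (z / t) by field; rewrite gt_eqF.
set w := s * t; have w0 : 0 <= w by rewrite mulr_ge0 // ltW.
have zt1 : 0 <= z / t <= 1 by rewrite divr_ge0 ?(ltW t0) //= ler_pdivrMr // mul1r.
have h1 : (z / t) ^+ 2 <= t `^ (- b) * y `^ b.
  apply: (@le_trans _ _ ((z / t) `^ b)).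
    rewrite -powR_mulrn; last by case/andP: zt1.
    case/andP: zt1; rewrite le_eqVlt => /orP[/eqP <- _|zt0 zt1].
      by rewrite !powR0 ?pnatr_eq0 // gt_eqF.
    by rewrite ger_powR ?zt0.
  rewrite powRM ?invr_ge0 ?(ltW t0) // mulrC powRV //.
  by rewrite ler_wpM2l ?powR_ge0 // ge0_ler_powR ?nnegrE // ltW.
have h2 : w ^+ 2 <= 2 * expR w.
  have := @expR_ge1Dxn R w 1 w0; rewrite -ler_pdivrMl //.
  by apply: le_trans; rewrite mulrC -[X in _ <= _ + X / _]/(w ^+ 2) lerDr.
have h3 : expR (w * (z / t)) <= expR w.
  by rewrite ler_expR ler_piMr //; case/andP: zt1.
rewrite exprMn mulrAC.
have -> : 2 * expR (2 * w) = 2 * expR w * expR w by rewrite -mulrA -expRD; congr (_ * expR _); ring.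
apply: ler_pM.
- by apply: mulr_ge0; rewrite ?exprn_ge0 ?expR_ge0.
- by apply: exprn_ge0; case/andP: zt1.
- by apply: ler_pM => //; rewrite ?exprn_ge0 ?expR_ge0.
- exact: h1.
Qed.

(** For [u <= 1] the quadratic remainder is at most [u^b]; for [u >= 1] the
    exponential is at most 1 and [u] at most [u^b]. *)
Lemma expRN_le b u : 1 <= b <= 2 -> 0 <= u -> expR (- u) + u <= 1 + u `^ b.
Proof.
move=> /andP[b1 b2] u0.
have [u1|u1] := leP 1 u.
  apply: lerD; first by rewrite expR_le1 oppr_le0.
  exact: le1r_powR.
have [->|un0] := eqVneq u 0.
  by rewrite oppr0 expR0 addr0 lerDl powR_ge0.
have up : 0 < u by rewrite lt_neqAle eq_sym un0.
have h : expR (- u) <= (1 + u)^-1.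
  rewrite expRN lef_pV2 ?posrE ?expR_gt0 ?expR_ge1Dx //.
  by rewrite ltr_wpDr.
apply: (@le_trans _ _ (1 + u ^+ 2)).
  rewrite -lerBrDr; apply: (le_trans h).
  have p1 : 0 < 1 + u by rewrite ltr_wpDr.
  rewrite -[X in X <= _]mul1r ler_pdivrMr //.
  rewrite -subr_ge0 (_ : _ - 1 = u ^+ 3); last by ring.
  by rewrite exprn_ge0.
rewrite lerD2l -powR_mulrn // ger_powR // up ltW //.
Qed.

End ElementaryInequalities.

(** * One big jump *)

Section IndependentTails.
Context d (T : measurableType d) (R : realType) (P : probability T R).
Context (H : R -> R) (alpha : R) (HH : rv_tail H alpha) (a0 : 0 < alpha).
Implicit Types (U V : T -> R) (a b x y : R).

Lemma pr_indep2 d1 d2 (S1 : measurableType d1) (S2 : measurableType d2)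
  (U : T -> S1) (V : T -> S2) A B : measurable_fun setT U -> measurable_fun setT V ->
  indep2 P U V -> measurable A -> measurable B ->
  pr P (U @^-1` A `&` V @^-1` B) = pr P (U @^-1` A) * pr P (V @^-1` B).
Proof.
move=> mU mV h mA mB; rewrite /pr h // fineM // fin_num_measure //.
  by rewrite -[X in measurable X]setTI; exact: mU.
by rewrite -[X in measurable X]setTI; exact: mV.
Qed.

Lemma tail_indep U V x y : measurable_fun setT U -> measurable_fun setT V ->
  indep2 P U V ->
  pr P ([set w | x < U w] `&` [set w | y < V w]) = tail P U x * tail P V y.
Proof.
by move=> mU mV h; rewrite /tail !gt_setE pr_indep2.
Qed.

Lemma tail_cvg0 (F : R -> R) a : F x / H x @[x --> +oo] --> a -> F x @[x --> +oo] --> 0.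
Proof.
move=> Fa; have [_ H0 _] := HH.
have -> : F = (fun x => F x / H x * H x) by apply/funext => x; rewrite divfK // gt_eqF.
by rewrite -(mulr0 a); apply: cvgM => //; exact: rv_tail_cvg0 HH a0.
Qed.

Lemma ratio_lim_ge0 (Z : T -> R) c :
  tail P Z x / H x @[x --> +oo] --> (c : R) -> 0 <= c.
Proof.
have [_ H0 _] := HH.
move=> Zc; have Zc' : cvg (tail P Z x / H x @[x --> +oo]) by apply/cvg_ex; exists c.
rewrite -(cvg_lim _ Zc) //; apply: limr_ge => //.
by apply: nearW => x; rewrite divr_ge0 ?pr_ge0 // ltW.
Qed.

(** One big jump. When [U + V > x], one of the two exceeds [t x] or both exceed
    [(1 - t) x], and by independence the latter has probability [o(H x)].
    Conversely it suffices that one of them exceeds [x], and the two events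
    overlap with probability [o(H x)]. *)
Lemma tail_add_indep U V a b : measurable_fun setT U -> measurable_fun setT V ->
  (forall w, 0 <= U w) -> (forall w, 0 <= V w) -> indep2 P U V ->
  tail P U x / H x @[x --> +oo] --> a -> tail P V x / H x @[x --> +oo] --> b ->
  tail P (fun w => U w + V w) x / H x @[x --> +oo] --> a + b.
Proof.
move=> mU mV U0 V0 indUV Ua Vb; have [_ H0 _] := HH.
have mUV : measurable_fun setT (fun w => U w + V w) by exact: measurable_funD.
have ab0 : 0 <= a + b by rewrite addr_ge0 ?(ratio_lim_ge0 Ua) ?(ratio_lim_ge0 Vb).
apply: (cvg_of_near_bounds H0) => e e0.
- have [t [/andP[t0 t1] te]] := powR_scale_lt a0 ab0 e0.
  have t1' : 0 < 1 - t by rewrite subr_gt0.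
  pose G x := tail P U (t * x) + tail P V (t * x) +
              tail P U ((1 - t) * x) * tail P V ((1 - t) * x).
  have Gle x : 0 <= x -> tail P (fun w => U w + V w) x <= G x.
    move=> x0; rewrite /G -tail_indep // /tail.
    have mU' z : measurable [set w | z < U w] by exact: measurable_gtr.
    have mV' z : measurable [set w | z < V w] by exact: measurable_gtr.
    apply: (@le_trans _ _ (pr P ([set w | t * x < U w] `|` [set w | t * x < V w]) +
        pr P ([set w | (1 - t) * x < U w] `&` [set w | (1 - t) * x < V w]))); last first.
      by rewrite lerD2r pr_setU.
    apply: le_pr_setU; [exact: measurable_gtr|exact: measurableU|exact: measurableI|].
    move=> w /= xw.
    have [Ut|Ut] := ltP (t * x) (U w); first by left; left.
    have [Vt|Vt] := ltP (t * x) (V w); first by left; right.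
    by right; split; lra.
  have GH : G x / H x @[x --> +oo] --> (a + b) * t `^ (- alpha).
    have -> : (fun x => G x / H x) = (fun x => tail P U (t * x) / H x +
        tail P V (t * x) / H x + tail P U ((1 - t) * x) / H x * tail P V ((1 - t) * x)).
      by apply/funext => x; rewrite /G !mulrDl; congr (_ + _); rewrite mulrAC.
    have -> : (a + b) * t `^ (- alpha) = a * t `^ (- alpha) + b * t `^ (- alpha) +
        (a * (1 - t) `^ (- alpha)) * 0 by rewrite mulr0 addr0 mulrDl.
    apply: cvgD; last apply: cvgM.
    + by apply: cvgD; exact: rv_tail_scale_cvg.
    + exact: rv_tail_scale_cvg.
    + by apply: (cvg_scale t1'); exact: tail_cvg0 Vb.
  near=> x; apply: (@le_trans _ _ (G x)).
    by apply: Gle; near: x; exact: near_ge.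
  by near: x; exact: near_le_of_cvg H0 GH te.
- pose G x := tail P U x + tail P V x - tail P U x * tail P V x.
  have Gle x : 0 <= x -> G x <= tail P (fun w => U w + V w) x.
    move=> x0; rewrite /G lerBlDr -tail_indep // /tail.
    have mU' : measurable [set w | x < U w] by exact: measurable_gtr.
    have mV' : measurable [set w | x < V w] by exact: measurable_gtr.
    have mS : measurable [set w | x < U w + V w] by exact: measurable_gtr.
    apply: (@le_trans _ _ (pr P ([set w | x < U w] `|` [set w | x < V w]) +
        pr P ([set w | x < U w] `&` [set w | x < V w]))).
      rewrite -lee_fin !EFinD !pr_EFin //; [|exact: measurableI|exact: measurableU].
      rewrite measureUfinl // ?subeK //; last first.
        by rewrite -ge0_fin_numE // fin_num_measure.
      by rewrite fin_num_measure //; exact: measurableI.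
    rewrite lerD2r; apply: le_pr => //; first exact: measurableU.
    by move=> w /= [|] h; apply: (lt_le_trans h); rewrite ?lerDl ?lerDr.
  have GH : G x / H x @[x --> +oo] --> a + b.
    have -> : (fun x => G x / H x) = (fun x => tail P U x / H x +
        tail P V x / H x - tail P U x / H x * tail P V x).
      by apply/funext => x; rewrite /G !mulrDl; congr (_ + _); rewrite mulNr mulrAC.
    rewrite -[X in _ --> X]subr0 -(mulr0 a).
    by apply: cvgB; [exact: cvgD | apply: cvgM => //; exact: tail_cvg0 Vb].
  near=> x; apply: (@le_trans _ _ (G x)).
    near: x; apply: near_ge_of_cvg H0 GH _.
    by rewrite ltrBlDr ltrDl.
  by apply: Gle; near: x; exact: near_ge.
Unshelve. all: by end_near. Qed.

End IndependentTails.

(** * Partial sums of independent copies *)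

Section PartialSums.
Context d (T : measurableType d) (R : realType) (P : probability T R).
Context (X0 : {RV P >-> R}) (X : nat -> {RV P >-> R}).
Context (X0_ge0 : forall w, 0 <= X0 w) (X_ge0 : forall j w, 0 <= X j w).
Context (hident : forall j, eq_in_law P P (X j) X0) (hindep : independent_seq P X).
Context (H : R -> R) (alpha : R) (HH : rv_tail H alpha) (a1 : 1 < alpha).
Context (c1 : R) (hc1 : tail P X0 x / H x @[x --> +oo] --> c1).
Context (b m M : R) (b12 : 1 < b <= 2).
Context (hm : (\int[P]_w (X0 w)%:E = m%:E)%E).
Context (hM : (\int[P]_w (X0 w `^ b)%:E = M%:E)%E).

Local Notation S k := (fun w => \sum_(j < k) X j w).

Let a0 : 0 < alpha. Proof. exact: lt_trans a1. Qed.

Lemma measurable_partial_sum k : measurable_fun setT (S k).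
Proof. by apply: measurable_sum => j. Qed.

Lemma partial_sum_ge0 k w : 0 <= S k w.
Proof. by apply: sumr_ge0. Qed.

Lemma tail_ident j x : tail P (X j) x = tail P X0 x.
Proof. by rewrite /tail /pr !gt_setE hident. Qed.

Lemma integral_ident j (f : R -> \bar R) : measurable_fun setT f ->
  (forall x, (0 <= f x)%E) -> (\int[P]_w f (X j w) = \int[P]_w f (X0 w))%E.
Proof.
move=> mf f0.
rewrite -[LHS](@ge0_integral_distribution _ _ _ _ _ P (X j) f) //.
rewrite -[RHS](@ge0_integral_distribution _ _ _ _ _ P X0 f) //.
by apply: eq_measure_integral => A mA _; exact: hident.
Qed.

Lemma mean_ge0 : 0 <= m.
Proof. by rewrite -lee_fin -hm integral_ge0 // => w _; rewrite lee_fin. Qed.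

Lemma moment_ge0 : 0 <= M.
Proof. by rewrite -lee_fin -hM integral_ge0 // => w _; rewrite lee_fin powR_ge0. Qed.

Lemma tail_partial_sum k : tail P (S k) x / H x @[x --> +oo] --> k%:R * c1.
Proof.
elim: k => [|k IH].
  rewrite mul0r; apply: cvg_near_cst; near=> x.
  rewrite /tail (_ : [set _ | _] = set0); first by rewrite /pr measure0 mul0r.
  apply/seteqP; split => w //=; rewrite big_ord0 ltNge.
  by move/negP; apply; near: x; exact: near_ge.
have -> : S k.+1 = (fun w => S k w + X k w).
  by apply/funext => w; rewrite big_ord_recr.
rewrite -natr1 mulrDl mul1r; apply: (tail_add_indep HH a0) => //.
- exact: measurable_partial_sum.
- exact: partial_sum_ge0.
- by apply: (partial_sum_indep hindep k (phi := id)).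
- by under eq_fun do rewrite tail_ident.
Unshelve. all: by end_near. Qed.

Lemma mgf_truncated_le t s : 0 < t -> 0 <= s ->
  (\int[P]_w (expR (s * Num.min (X0 w) t))%:E <=
    (1 + s * m + 2 * expR (2 * (s * t)) * (t `^ (- b) * M))%:E)%E.
Proof.
move=> t0 s0; have b02 : 0 < b <= 2.
  by case/andP: b12 => b1 ->; rewrite (lt_trans ltr01).
have mpow : measurable_fun setT (fun w => X0 w `^ b).
  exact: (measurableT_comp (measurable_powR b)).
have c0 : 0 <= 2 * expR (2 * (s * t)) * t `^ (- b).
  by rewrite !mulr_ge0 ?expR_ge0 ?powR_ge0.
apply: (@le_trans _ _ (\int[P]_w ((1 + s * X0 w)%:E +
   (2 * expR (2 * (s * t)) * t `^ (- b) * X0 w `^ b)%:E))%E).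
  apply: ge0_le_integral => //.
  - apply/measurable_EFinP; apply: (measurableT_comp (@measurable_expR R)).
    by apply: measurable_funM => //; exact: measurable_minr.
  - apply: emeasurable_funD; apply/measurable_EFinP.
      by apply: measurable_funD => //; exact: measurable_funM.
    exact: measurable_funM.
  - by move=> w _; rewrite -EFinD lee_fin -mulrA; exact: expR_truncated_le.
rewrite ge0_integralD //=; last 4 first.
- by move=> w _; rewrite lee_fin addr_ge0 // mulr_ge0.
- by apply/measurable_EFinP; apply: measurable_funD => //; exact: measurable_funM.
- by move=> w _; rewrite lee_fin mulr_ge0 // powR_ge0.
- by apply/measurable_EFinP; exact: measurable_funM.
under eq_integral do rewrite EFinD EFinM.
rewrite ge0_integralD //=; last 2 first.
- by move=> w _; rewrite -EFinM lee_fin mulr_ge0.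
- by apply/measurable_EFinP; exact: measurable_funM.
rewrite integral_one.
rewrite ge0_integralZl_EFin //; last 2 first.
- by move=> w _; rewrite lee_fin.
- exact/measurable_EFinP.
rewrite hm.
under eq_integral do rewrite EFinM.
rewrite ge0_integralZl_EFin //; last 2 first.
- by move=> w _; rewrite lee_fin powR_ge0.
- exact/measurable_EFinP.
rewrite hM -!EFinM -[1%E]/(1%:E) -!EFinD lee_fin.
by rewrite -(mulrA _ (t `^ _) M).
Qed.

Lemma laplace_le s : 0 <= s ->
  (\int[P]_w (expR (- s * X0 w))%:E <= (1 - s * m + s `^ b * M)%:E)%E.
Proof.
move=> s0; have b12' : 1 <= b <= 2 by case/andP: b12 => /ltW -> ->.
have mpow : measurable_fun setT (fun w => X0 w `^ b).
  exact: (measurableT_comp (measurable_powR b)).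
have mexp : measurable_fun setT (fun w => (expR (- s * X0 w))%:E).
  apply/measurable_EFinP; apply: (measurableT_comp (@measurable_expR R)).
  exact: measurable_funM.
rewrite addrAC EFinB leeBrDr //.
have -> : (s * m)%:E = (\int[P]_w (s * X0 w)%:E)%E.
  under eq_integral do rewrite EFinM.
  rewrite ge0_integralZl_EFin ?hm //; last exact/measurable_EFinP.
  by move=> w _; rewrite lee_fin.
rewrite -ge0_integralD //; last 2 first.
- by move=> w _; rewrite lee_fin mulr_ge0.
- by apply/measurable_EFinP; exact: measurable_funM.
apply: (@le_trans _ _ (\int[P]_w (1 + (s `^ b * X0 w `^ b)%:E))%E).
  apply: ge0_le_integral => //.
  - by move=> w _; rewrite adde_ge0 // lee_fin ?expR_ge0 // mulr_ge0.
  - by apply: emeasurable_funD => //; apply/measurable_EFinP; exact: measurable_funM.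
  - by apply: emeasurable_funD => //; apply/measurable_EFinP; exact: measurable_funM.
  - move=> w _; rewrite -EFinD lee_fin -powRM // mulNr.
    by apply: expRN_le => //; exact: mulr_ge0.
rewrite ge0_integralD //=; last 2 first.
- by move=> w _; rewrite lee_fin mulr_ge0 // powR_ge0.
- by apply/measurable_EFinP; exact: measurable_funM.
rewrite integral_one.
under eq_integral do rewrite EFinM.
rewrite ge0_integralZl_EFin ?powR_ge0 //; last 2 first.
- by move=> w _; rewrite lee_fin powR_ge0.
- exact/measurable_EFinP.
by rewrite hM.
Qed.

Lemma chernoff_pr k (phi : R -> R) (r y : R) : measurable_fun setT phi ->
  (\int[P]_w (expR (phi (X0 w)))%:E <= r%:E)%E ->
  pr P [set w | y <= \sum_(j < k) phi (X j w)] <= r ^+ k * expR (- y).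
Proof.
move=> mphi hr.
have mexp : measurable_fun setT (expR \o phi).
  exact: (measurableT_comp (@measurable_expR R)).
have -> : [set w | y <= \sum_(j < k) phi (X j w)] =
    [set w | expR y <= expR (\sum_(j < k) phi (X j w))].
  by apply/seteqP; split => w /=; rewrite ler_expR.
rewrite expRN; apply: markov_pr.
- apply: (measurableT_comp (@measurable_expR R)); apply: measurable_sum => j.
  exact: (measurableT_comp mphi).
- by move=> w; exact: expR_ge0.
- exact: expR_gt0.
- apply: (integral_expR_sum_le hindep) => // j.
  rewrite (@integral_ident j (fun x => (expR (phi x))%:E)) //.
    exact/measurable_EFinP.
Qed.

Lemma exprn_le_expR (u : R) k : 0 <= 1 + u -> (1 + u) ^+ k <= expR (k%:R * u).
Proof.
move=> u0; rewrite expRM_natl lerXn2r ?nnegrE ?expR_ge0 //.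
exact: expR_ge1Dx.
Qed.

(** A lower law of large numbers: at a small [s] the Laplace transform of one
    mark is at most [1 - s m + s^b M], and [s^b] is negligible against [s]
    because [b > 1], so the [k]-th power of this bound beats [e^(-s (1-e) m k)]
    geometrically. Nonnegativity of the marks replaces a second moment. *)
Lemma lln_lower e : 0 < m -> 0 < e ->
  exists N, forall k, (N <= k)%N -> pr P [set w | S k w <= (1 - e) * m * k%:R] <= e.
Proof.
move=> m0 e0; have /andP[b1 b2] := b12.
have b10 : 0 < b - 1 by rewrite subr_gt0.
have M1 : 0 < M + 1 by rewrite ltr_wpDl // moment_ge0.
(* chosen so that [s^(b - 1) (M + 1) = e m / 2] *)
pose s0 := e * m / 2 / (M + 1).
have s00 : 0 < s0 by rewrite !divr_gt0 // mulr_gt0.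
pose s := s0 `^ (b - 1)^-1.
have sp : 0 < s by rewrite powR_gt0.
have sb : s `^ b = s * s0.
  rewrite -(mulr_powRB1 (ltW sp)) ?(lt_trans ltr01) //.
  by rewrite -powRrM mulVf ?gt_eqF // powRr1 // ltW.
pose u := - s * m + s `^ b * M.
have hu : 0 <= 1 + u.
  have := laplace_le (ltW sp).
  rewrite -lee_fin /u addrA mulNr => /(le_trans _); apply.
  by apply: integral_ge0 => w _; rewrite lee_fin expR_ge0.
pose q := expR (- (s * (e * m) / 2)).
have q01 : `|q| < 1.
  by rewrite ger0_norm ?expR_ge0 // expR_lt1 oppr_lt0 divr_gt0 // !mulr_gt0.
have hq : expR (u + s * ((1 - e) * m)) <= q.
  rewrite ler_expR /u sb.
  have h : s * s0 * M <= s * (e * m / 2).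
    rewrite -mulrA ler_wpM2l ?(ltW sp) // /s0 mulrAC ler_pdivrMr //.
    by rewrite ler_wpM2l ?lerDl // ltW // divr_gt0 // mulr_gt0.
  have -> : s * (e * m) / 2 = s * (e * m / 2) by rewrite !mulrA.
  apply: (@le_trans _ _ (- s * m + s * (e * m / 2) + s * ((1 - e) * m))).
    by rewrite lerD2r lerD2l.
  by rewrite le_eqVlt; apply/orP; left; apply/eqP; field.
have /cvgrPdist_le /(_ _ e0) [N _ hN] := cvg_geometric 1 q01.
exists N => k Nk.
have -> : [set w | S k w <= (1 - e) * m * k%:R] =
    [set w | - (s * ((1 - e) * m * k%:R)) <= \sum_(j < k) (- s * X j w)].
  apply/seteqP; split => w /=; rewrite -mulr_sumr mulNr lerN2 ler_pM2l //.
apply: (@le_trans _ _ ((1 + u) ^+ k * expR (- - (s * ((1 - e) * m * k%:R))))).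
  apply: (@chernoff_pr k (fun x => - s * x)); first exact: measurable_funM.
  by have := laplace_le (ltW sp); rewrite /u addrA mulNr.
rewrite opprK; apply: (@le_trans _ _ (q ^+ k)).
  apply: (@le_trans _ _ (expR (k%:R * u) * expR (s * ((1 - e) * m * k%:R)))).
    by rewrite ler_wpM2r ?expR_ge0 // exprn_le_expR.
  rewrite -expRD (_ : _ + _ = k%:R * (u + s * ((1 - e) * m))); last by ring.
  by rewrite expRM_natl lerXn2r ?nnegrE ?expR_ge0.
have := hN k Nk; rewrite sub0r normrN /geometric /= mul1r.
by rewrite ger0_norm // exprn_ge0 // expR_ge0.
Qed.

(** An inequality of Fuk and Nagaev. Either some mark exceeds [t = eta x], with
    probability at most [k] times the tail of one mark, or the sum of the marks
    truncated at [t] exceeds its mean by [dl x]. With [e^(2 s t) = t^(b - 1)] the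
    exponential moments of the centred truncated sums stay bounded over
    [k <= B x], and Chernoff's bound on the second event is a constant times
    [e^(- s dl x)]. The value of
    [eta] turns this into [t^(- (alpha + 1))], negligible against [H x]. The
    factor [k] in the bound makes it summable against the law of [K]. *)
Lemma partial_sum_large_dev B dl : 0 < B -> 0 < dl -> exists2 C, 0 <= C &
  \forall x \near +oo, forall k, k%:R <= B * x ->
    pr P [set w | m * k%:R + dl * x < S k w] <= C * k%:R * H x.
Proof.
move=> B0 dl0; have [_ H0 _] := HH; have /andP[b1 b2] := b12.
have b10 : 0 < b - 1 by rewrite subr_gt0.
have a10 : 0 < alpha + 1 by rewrite ltr_wpDr.
(* makes [s (dl x)] equal to [(alpha + 1) ln t] *)
pose eta := (b - 1) * dl / (2 * (alpha + 1)).
have eta0 : 0 < eta by rewrite divr_gt0 ?mulr_gt0.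
have [|cl cl0 hl] := @rv_tail_lower R H alpha (alpha + 1) HH.
  by rewrite a0 /= ltrDl.
pose C3 := c1 * eta `^ (- alpha) + 1.
have hF : \forall x \near +oo, tail P X0 (eta * x) <= C3 * H x.
  apply: near_le_of_cvg H0 (rv_tail_scale_cvg HH eta0 hc1) _.
  by rewrite ltrDl.
pose C1 := expR (2 * M * B / eta).
pose C2 := C1 * eta `^ (- (alpha + 1)) / cl.
have C20 : 0 <= C2 by rewrite !mulr_ge0 ?expR_ge0 ?powR_ge0 ?invr_ge0 ?(ltW cl0).
exists (`|C3| + C2); first by rewrite addr_ge0.
near=> x.
have x0 : 0 < x by near: x; exact: near_gt.
have x1 : eta^-1 <= x by near: x; exact: near_ge.
have hFx : tail P X0 (eta * x) <= C3 * H x by near: x.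
have hlx : cl * x `^ (- (alpha + 1)) <= H x by near: x.
move=> k kB.
have [k0|k0] := posnP k.
  rewrite k0 !mulr0 mul0r add0r (_ : [set _ | _] = set0); first by rewrite /pr measure0.
  apply/seteqP; split => w //=; rewrite big_ord0 ltNge.
  by rewrite mulr_ge0 // ltW.
pose t := eta * x; have t0 : 0 < t by rewrite mulr_gt0.
have t1 : 1 <= t.
  by rewrite /t -ler_pdivrMl // mulr1.
(* makes [e^(2 s t)] equal to [t^(b - 1)] *)
pose s := (b - 1) * ln t / (2 * t).
have s0 : 0 <= s.
  apply: divr_ge0; apply: mulr_ge0 => //; [exact: ltW | exact: ln_ge0 | exact: ltW].
pose r := 1 + s * m + 2 * expR (2 * (s * t)) * (t `^ (- b) * M).
have rE : r = 1 + (s * m + 2 * M / t).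
  rewrite /r; have -> : 2 * (s * t) = (b - 1) * ln t by rewrite /s; field; rewrite gt_eqF.
  have -> : expR ((b - 1) * ln t) = t `^ (b - 1) by rewrite /powR gt_eqF.
  rewrite -addrA; congr (_ + (_ + _)).
  have -> : 2 * t `^ (b - 1) * (t `^ (- b) * M) = 2 * (t `^ (b - 1) * t `^ (- b)) * M by ring.
  rewrite -powRD; last by rewrite (gt_eqF t0) implybT.
  have -> : b - 1 - b = -1 by ring.
  by rewrite powR_inv1 ?(ltW t0) // mulrAC.
have M0 := moment_ge0; have m0 := mean_ge0.
pose A1 := \big[setU/set0]_(j < k) [set w | t < X j w].
pose A2 := [set w | s * (m * k%:R + dl * x) <= \sum_(j < k) (s * Num.min (X j w) t)].
have mphi : measurable_fun setT (fun y : R => s * Num.min y t).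
  by apply: measurable_funM => //; exact: measurable_minr.
have mA1 : measurable A1 by apply: bigsetU_measurable => j _; exact: measurable_gtr.
have mA2 : measurable A2.
  apply: measurable_ger; apply: measurable_sum => j.
  exact: (measurableT_comp mphi).
apply: (@le_trans _ _ (pr P A1 + pr P A2)).
  apply: le_pr_setU => //; first exact/measurable_gtr/measurable_partial_sum.
  move=> w /= hw; have [|nA1] := pselect (A1 w); first by left.
  right; rewrite /A2 /= -mulr_sumr ler_wpM2l //; apply: ltW.
  rewrite (eq_bigr (fun j : 'I_k => X j w)) // => j _.
  apply/min_idPl; rewrite leNgt; apply/negP => tX; apply: nA1.
  by rewrite /A1 -(bigcup_mkord k (fun j => [set w | t < X j w])); exists j => //=.
have h1 : pr P A1 <= k%:R * (C3 * H x).
  apply: (@le_trans _ _ (\sum_(j < k) tail P (X j) t)).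
    by apply: (@le_pr_sum _ _ _ P A1 (fun j => [set w | t < X j w])) => // j; exact: measurable_gtr.
  rewrite (eq_bigr (fun=> tail P X0 t)); last by move=> j _; rewrite tail_ident.
  by rewrite sumr_const card_ord -[leLHS]mulr_natl ler_wpM2l.
have h2 : pr P A2 <= C2 * H x.
  apply: (le_trans (chernoff_pr k _ mphi (mgf_truncated_le t0 s0))).
  rewrite -/r rE.
  have st0 : 0 <= s * m + 2 * M / t 
    by apply: addr_ge0; [exact: mulr_ge0 | apply: divr_ge0; [exact: mulr_ge0 | exact: ltW]].
  apply: (@le_trans _ _ (expR (k%:R * (s * m + 2 * M / t)) * expR (- (s * (m * k%:R + dl * x))))).
    by rewrite ler_wpM2r ?expR_ge0 // exprn_le_expR // addr_ge0.
  rewrite -expRD.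
  have -> : k%:R * (s * m + 2 * M / t) - s * (m * k%:R + dl * x) =
      2 * M * (k%:R / t) - s * (dl * x) by ring.
  have -> : s * (dl * x) = (alpha + 1) * ln t.
    rewrite /s /t /eta; field.
    by rewrite !gt_eqF.
  rewrite expRB.
  have -> : expR ((alpha + 1) * ln t) = t `^ (alpha + 1) by rewrite /powR gt_eqF.
  have hC1 : expR (2 * M * (k%:R / t)) <= C1.
    rewrite ler_expR -[leRHS]mulrA ler_wpM2l ?mulr_ge0 // ler_pdivrMr // /t mulrA.
    by rewrite divfK // gt_eqF.
  apply: (@le_trans _ _ (C1 * t `^ (- (alpha + 1)))).
    by rewrite powRN ler_wpM2r ?invr_ge0 ?powR_ge0.
  rewrite /t powRM ?(ltW eta0) ?(ltW x0) // mulrA /C2 -[leRHS]mulrA ler_wpM2l //.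
    by rewrite mulr_ge0 ?expR_ge0 ?powR_ge0.
  by rewrite ler_pdivlMl.
apply: (le_trans (lerD h1 h2)).
have Hx := H0 x.
have k1 : 1 <= k%:R :> R by rewrite ler1n.
rewrite [(_ + C2) * _]mulrDl [leRHS]mulrDl; apply: lerD.
  by rewrite mulrA ler_wpM2r ?(ltW Hx) // mulrC ler_wpM2r // ler_norm.
by rewrite ler_wpM2r ?(ltW Hx) // ler_peMr.
Unshelve. all: by end_near. Qed.

End PartialSums.

(** * The compound sum *)

Section CompoundSum.
Context d (T : measurableType d) (R : realType) (P : probability T R).
Context (X0 : {RV P >-> R}) (X : nat -> {RV P >-> R}) (K : {RV P >-> nat}).
Context (X0_ge0 : forall w, 0 <= X0 w) (X_ge0 : forall j w, 0 <= X j w).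
Context (hident : forall j, eq_in_law P P (X j) X0) (hindep : independent_seq P X).
Context (hindK : independent_sigma P (sigma_of_seq X)
           (sigma_of (fun w => (X0 w, K w)))).
Context (H : R -> R) (alpha : R) (HH : rv_tail H alpha) (a1 : 1 < alpha).
Context (c1 : R) (hc1 : tail P X0 x / H x @[x --> +oo] --> c1).
Context (b m M : R) (b12 : 1 < b <= 2) (m0 : 0 < m).
Context (hm : (\int[P]_w (X0 w)%:E = m%:E)%E).
Context (hM : (\int[P]_w (X0 w `^ b)%:E = M%:E)%E).
Context (hK : (\int[P]_w ((K w)%:R%:E : \bar R) < +oo)%E).
Context (cT : R) (hcT : tail P (fun w => X0 w + m * (K w)%:R) x / H x @[x --> +oo] --> cT).

Local Notation S k := (fun w => \sum_(j < k) X j w).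
Local Notation Lin := (fun w => X0 w + m * (K w)%:R).
Local Notation D := (fun w => X0 w + \sum_(j < K w) X j w).
Local Notation p k := (pr P [set w | K w = k]).
Local Notation EK := (fine (\int[P]_w ((K w)%:R%:E : \bar R))%E).

Let a0 : 0 < alpha. Proof. exact: lt_trans a1. Qed.

Lemma measurable_level k : measurable [set w | K w = k].
Proof. by rewrite -[X in measurable X]setTI; exact: (measurable_funPT K _ [set k]). Qed.

Lemma measurable_natr : measurable_fun setT (fun w => (K w)%:R : R).
Proof.
move=> _ Y mY; rewrite setTI.
have -> : (fun w => (K w)%:R : R) @^-1` Y = K @^-1` [set k | Y k%:R] by [].
by rewrite -[X in measurable X]setTI; exact: (measurable_funPT K).
Qed.

Lemma measurable_linear_comb (u v : R) :
  measurable_fun setT (fun w => u * X0 w + v * (K w)%:R).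
Proof.
apply: measurable_funD; apply: measurable_funM => //.
exact: measurable_natr.
Qed.

Lemma measurable_lin : measurable_fun setT Lin.
Proof.
by apply: measurable_funD => //; apply: measurable_funM => //; exact: measurable_natr.
Qed.

Lemma measurable_compound : measurable_fun setT D.
Proof.
move=> _ Y mY; rewrite setTI.
have -> : D @^-1` Y = \bigcup_k ([set w | K w = k] `&` (fun w => X0 w + S k w) @^-1` Y).
  apply/seteqP; split => w /=.
    by move=> h; exists (K w).
  by move=> [k _ /= [->]].
apply: bigcup_measurable => k _; apply: measurableI; first exact: measurable_level.
rewrite -[X in measurable X]setTI.
have mXS : measurable_fun setT (fun w => X0 w + S k w).
  by apply: measurable_funD => //; exact: measurable_partial_sum.
exact: mXS.
Qed.

Lemma measurable_levelI k (A : set R) : measurable A ->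
  measurable [set w | K w = k /\ A (X0 w)].
Proof.
move=> mA; apply: (@measurableI _ _ [set w | K w = k] (X0 @^-1` A)).
  exact: measurable_level.
by rewrite -[X in measurable X]setTI; exact: measurable_funPT.
Qed.

Lemma pr_level_indep k (A B : set R) : measurable A -> measurable B ->
  pr P ([set w | K w = k /\ A (X0 w)] `&` [set w | B (S k w)]) =
  pr P [set w | K w = k /\ A (X0 w)] * pr P [set w | B (S k w)].
Proof.
move=> mA mB.
have mS : measurable [set w | B (S k w)].
  have mS0 : measurable_fun setT (S k) by exact: measurable_partial_sum.
  by have := mS0 measurableT _ mB; rewrite setTI.
rewrite setIC /pr hindK; last 2 first.
- exact: partial_sum_sigma_seq.
- exists (A `*` [set k]); first exact: measurableX.
  by rewrite setTI; apply/seteqP; split => w /= [].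
by rewrite fineM ?fin_num_measure ?muleC // 1?mulrC //; exact: measurable_levelI.
Qed.

Lemma cvg_sum_ord n (f : nat -> R -> R) (l : nat -> R) :
  (forall k, f k x @[x --> +oo] --> l k) ->
  \sum_(k < n) f k x @[x --> +oo] --> \sum_(k < n) l k.
Proof.
move=> fl; elim: n => [|n IH].
  by under eq_fun do rewrite big_ord0; rewrite big_ord0; exact: cvg_cst.
under eq_fun do rewrite big_ord_recr /=; rewrite big_ord_recr /=.
exact: cvgD.
Qed.

Lemma partial_mean_le n : \sum_(k < n) k%:R * p k <= EK.
Proof.
have c := cvg_partial_mean (measurable_funPT K) hK.
rewrite -(cvg_lim _ c) //; apply: (@nondecreasing_cvgn_le _ (fun n => \sum_(k < n) k%:R * p k)).
  apply/nondecreasing_seqP => k; rewrite big_ord_recr /= lerDl mulr_ge0 //.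
  exact: pr_ge0.
by apply/cvg_ex; exists EK.
Qed.

Lemma EK_ge0 : 0 <= EK.
Proof. by apply: le_trans (partial_mean_le 0); rewrite big_ord0. Qed.

(** Suppose [D > x] while [X + m K <= t x], with [t = 1 - dl]; then [K <= x / m]
    and, for [k] the value of [K], [S k] exceeds [m k + dl x]. For [k < n], either
    [S k > t x], or both [X > dl x] and [S k > dl x], two events that are
    independent given [K = k] and whose probabilities multiply to [o(H x)]. For
    [k >= n] the large deviation bound applies, and its sum is at most a constant
    times [H x] and a remainder of the series for the mean of [K], small when [n]
    is large. *)
Lemma compound_upper e : 0 < e ->
  \forall x \near +oo, tail P D x <= (cT + EK * c1 + e) * H x.
Proof.
move=> e0; have [_ H0 _] := HH.
have c10 := ratio_lim_ge0 HH hc1; have cT0 := ratio_lim_ge0 HH hcT.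
have e20 : 0 < e / 2 by rewrite divr_gt0.
have c0 : 0 <= cT + EK * c1 by rewrite addr_ge0 // mulr_ge0 // EK_ge0.
have [t [/andP[t0 t1] te]] := powR_scale_lt a0 c0 e20.
pose dl := 1 - t; have dl0 : 0 < dl by rewrite subr_gt0.
have mV0 : 0 < m^-1 by rewrite invr_gt0.
have [C C0 hC] := partial_sum_large_dev X0_ge0 hident hindep HH a1 hc1 b12 hm hM mV0 dl0.
have [n hn] : exists n, C * (EK - \sum_(k < n) k%:R * p k) < e / 2.
  have CE : 0 < e / 2 / (C + 1) by rewrite divr_gt0 // ltr_wpDl.
  have /cvgrPdist_lt /(_ _ CE) [n _ hn] := cvg_partial_mean (measurable_funPT K) hK.
  exists n; have := hn n (leqnn n); rewrite ger0_norm ?subr_ge0 ?partial_mean_le //.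
  rewrite ltr_pdivlMr ?ltr_wpDl // => /(le_lt_trans _); apply.
  by rewrite mulrC ler_wpM2l ?lerDl // subr_ge0 partial_mean_le.
pose rest := C * (EK - \sum_(k < n) k%:R * p k).
pose g k x := tail P X0 (dl * x) * tail P (S k) (dl * x) + p k * tail P (S k) (t * x).
pose U x := tail P Lin (t * x) + \sum_(k < n) g k x + rest * H x.
have hS k := @tail_partial_sum _ _ _ _ _ _ X_ge0 hident hindep _ _ HH a1 _ hc1 k.
have UH : U x / H x @[x --> +oo] -->
    cT * t `^ (- alpha) + \sum_(k < n) (p k * (k%:R * c1 * t `^ (- alpha))) + rest.
  have -> : (fun x => U x / H x) =
      (fun x => tail P Lin (t * x) / H x + \sum_(k < n) (g k x / H x) + rest).
    apply/funext => x; rewrite /U 2!mulrDl mulr_suml -mulrA mulfV ?mulr1 //.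
    by rewrite gt_eqF.
  apply: cvgD; last exact: cvg_cst.
  apply: cvgD; first exact: rv_tail_scale_cvg.
  apply: (@cvg_sum_ord n (fun k x => g k x / H x)
    (fun k => p k * (k%:R * c1 * t `^ (- alpha)))) => k.
  have -> : (fun x => g k x / H x) = (fun x => tail P X0 (dl * x) * (tail P (S k) (dl * x) / H x) +
      p k * (tail P (S k) (t * x) / H x)).
    by apply/funext => x; rewrite /g mulrDl !mulrA.
  rewrite (_ : p k * (k%:R * c1 * t `^ (- alpha)) = 0 * (k%:R * c1 * dl `^ (- alpha)) +
    p k * (k%:R * c1 * t `^ (- alpha))); last by rewrite mul0r add0r.
  apply: cvgD; apply: cvgM.
  - by apply: (cvg_scale dl0); exact: (tail_cvg0 HH a0 hc1).
  - exact: rv_tail_scale_cvg.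
  - exact: cvg_cst.
  - exact: rv_tail_scale_cvg.
have lim_lt : cT * t `^ (- alpha) + \sum_(k < n) (p k * (k%:R * c1 * t `^ (- alpha))) + rest
    < cT + EK * c1 + e.
  have -> : cT + EK * c1 + e = cT + EK * c1 + e / 2 + e / 2 by field.
  rewrite ltrD //; apply: le_lt_trans te; rewrite mulrDl lerD2l.
  have -> : \sum_(k < n) (p k * (k%:R * c1 * t `^ (- alpha))) =
      (\sum_(k < n) k%:R * p k) * c1 * t `^ (- alpha).
    by rewrite !mulr_suml; apply: eq_bigr => k _; ring.
  by rewrite ler_wpM2r ?powR_ge0 // ler_wpM2r // partial_mean_le.
have hU := near_le_of_cvg H0 UH lim_lt.
near=> x; apply: (@le_trans _ _ (U x)); last by near: x.
have x0 : 0 < x by near: x; exact: near_gt.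
have xn : m * n%:R <= x by near: x; exact: near_ge.
have hCx : forall k, k%:R <= m^-1 * x ->
    pr P [set w | m * k%:R + dl * x < S k w] <= C * k%:R * H x by near: x.
pose N := (Num.truncn (x / m)).+1.
have xm0 : 0 <= x / m by rewrite divr_ge0 // ltW.
have nN : (n <= N)%N.
  rewrite ltnW // ltnS truncn_ge_nat // ler_pdivlMr // mulrC //.
pose G k := ([set w | K w = k /\ dl * x < X0 w] `&` [set w | dl * x < S k w]) `|`
            ([set w | K w = k /\ setT (X0 w)] `&` [set w | t * x < S k w]).
pose L k := [set w | K w = k /\ setT (X0 w)] `&` [set w | m * k%:R + dl * x < S k w].
pose F k := if (k < n)%N then G k else L k.
have mgtS k y : measurable [set w | y < S k w].
  by apply: measurable_gtr; exact: measurable_partial_sum.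
have mgt (y : R) : measurable [set u : R | y < u].
  exact: (measurable_gtr y (@measurable_id _ R setT)).
have mlev k A : measurable A -> measurable [set w | K w = k /\ A (X0 w)].
  exact: measurable_levelI.
have mG k : measurable (G k).
  apply: measurableU; apply: measurableI => //.
    exact: (mlev k [set u | dl * x < u]).
  exact: mlev.
have mL k : measurable (L k) by apply: measurableI => //; exact: mlev.
have mF k : measurable (F k) by rewrite /F; case: ifP.
have plev k : pr P [set w | K w = k /\ setT (X0 w)] = p k.
  by congr (pr P _); apply/seteqP; split => w /= => [[]|].
have prG k : pr P (G k) <= g k x.
  apply: (@le_trans _ _ (pr P ([set w | K w = k /\ dl * x < X0 w] `&` [set w | dl * x < S k w]) +
      pr P ([set w | K w = k /\ setT (X0 w)] `&` [set w | t * x < S k w]))).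
    apply: pr_setU; apply: measurableI => //; last exact: mlev.
    exact: (mlev k [set u | dl * x < u]).
  rewrite (pr_level_indep k (A := [set u | dl * x < u]) (B := [set u | dl * x < u])) //.
  rewrite (pr_level_indep k (A := setT) (B := [set u | t * x < u])) // plev.
  rewrite lerD2r ler_wpM2r ?pr_ge0 //; apply: le_pr => //.
  - exact: (mlev k [set u | dl * x < u]).
  - exact: measurable_gtr.
  - by move=> w /= [].
have prL k : (k < N)%N -> pr P (L k) <= C * H x * (k%:R * p k).
  move=> kN; rewrite /L (pr_level_indep k (A := setT) (B := [set u | m * k%:R + dl * x < u])) //.
  have kx : k%:R <= m^-1 * x.
    by rewrite mulrC -truncn_ge_nat // -ltnS.
  rewrite plev; apply: (le_trans (ler_wpM2l (pr_ge0 _ _) (hCx k kx))).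
  by rewrite le_eqVlt; apply/orP; left; apply/eqP; ring.
have cover : [set w | x < D w] `<=`
    [set w | t * x < Lin w] `|` \big[setU/set0]_(k < N) F k.
  move=> w /= xD; have [tT|Tt] := ltP (t * x) (Lin w); [by left|right].
  rewrite -bigcup_mkord.
  have mk : m * (K w)%:R <= x.
    apply: (@le_trans _ _ (Lin w)); first by rewrite lerDr.
    by apply: (le_trans Tt); rewrite ler_piMl // ltW.
  exists (K w).
    rewrite /= /N ltnS truncn_ge_nat // ler_pdivlMr // mulrC //.
  have mK0 : 0 <= m * (K w)%:R by rewrite mulr_ge0 // ltW.
  rewrite /F; case: ifP => _.
    rewrite /G /=; have [hX|hX] := ltP (dl * x) (X0 w).
      by left; split => //; rewrite /dl; rewrite /dl in hX; lra.
    by right; split => //; rewrite /dl in hX; lra.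
  by rewrite /L /=; split => //; rewrite /dl; lra.
have mD : measurable [set w | x < D w] by apply: measurable_gtr; exact: measurable_compound.
have mT : measurable [set w | t * x < Lin w] by apply: measurable_gtr; exact: measurable_lin.
have mUF : measurable (\big[setU/set0]_(k < N) F k) by exact: bigsetU_measurable.
apply: (le_trans (le_pr_setU P mD mT mUF cover)).
rewrite /U -addrA lerD2l.
apply: (le_trans (le_pr_sum P mUF mF (@subset_refl _ _))).
rewrite -(big_mkord xpredT (fun k => pr P (F k))) (big_cat_nat (n := n)) //=.
apply: lerD.
  rewrite big_mkord; apply: ler_sum => k _.
  by rewrite /F ltn_ord.
apply: (@le_trans _ _ (\sum_(n <= k < N) C * H x * (k%:R * p k))).
  rewrite !big_nat; apply: ler_sum => k /andP[nk kN].
  by rewrite /F ltnNge nk; exact: prL.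
rewrite -mulr_sumr /rest [leRHS]mulrAC ler_wpM2l ?mulr_ge0 ?(ltW (H0 _)) //.
rewrite lerBrDl -(big_mkord xpredT (fun k => k%:R * p k)) -big_cat_nat //=.
by rewrite big_mkord partial_mean_le.
Unshelve. all: by end_near. Qed.

Lemma pr_level_sum (A B : set T) e : measurable A -> measurable B -> 0 <= e ->
  (forall k, pr P (A `&` [set w | K w = k]) <= e * pr P (B `&` [set w | K w = k])) ->
  pr P A <= e * pr P B.
Proof.
move=> mA mB e0 AB.
have mI (C : set T) k : measurable C -> measurable (C `&` [set w | K w = k]).
  by move=> mC; apply: measurableI => //; exact: measurable_level.
have dec (C : set T) : measurable C ->
    P C = (\sum_(0 <= k <oo) P (C `&` [set w | K w = k]))%E.
  move=> mC; transitivity (P (\bigcup_k (C `&` [set w | K w = k]))); last first.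
    rewrite measure_bigcup; last 2 first.
    - by move=> k _; exact: mI.
    - by move=> i j _ _ [w [[_ /= <-] [_ /= <-]]].
    by apply: eq_eseriesl => // k; rewrite in_setT.
  by congr (P _); apply/seteqP; split => [w Cw|w [k _ []]] //; exists (K w).
rewrite -lee_fin EFinM !pr_EFin // (dec A mA) (dec B mB).
rewrite -nneseriesZl //.
apply: lee_nneseries => // k _.
by rewrite -!pr_EFin -?EFinM ?lee_fin //; exact: mI.
Qed.

(** When [X + m K > x / t], the law of large numbers makes [D] exceed [x] except
    with conditional probability at most [1 - t]: for [K] large the partial sum is at
    least [t m K], and for [K] bounded [X] alone is close enough to [X + m K]. When
    [X + m K <= x / t], an event of probability tending to 1, [S k > x] is enough
    and each of the first [n] values [k] of [K] contributes about
    [P(K = k) k c1 H x]. *)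
Lemma compound_lower e : 0 < e ->
  \forall x \near +oo, (cT + EK * c1 - e) * H x <= tail P D x.
Proof.
move=> e0; have [_ H0 _] := HH.
have c10 := ratio_lim_ge0 HH hc1; have cT0 := ratio_lim_ge0 HH hcT.
have e20 : 0 < e / 2 by rewrite divr_gt0.
have aS0 : 0 < alpha + 1 by rewrite ltr_wpDr.
have [t [/andP[t0 t1] te]] := powR_scale_lt aS0 cT0 e20.
have tV0 : 0 < t^-1 by rewrite invr_gt0.
have hte : cT - e / 2 < cT * t * t `^ alpha.
  have -> : cT * t * t `^ alpha = cT * t `^ (alpha + 1).
    by rewrite powRD ?(gt_eqF t0) ?implybT // powRr1 ?ltW //; ring.
  rewrite ltrBlDr -ltrBlDl.
  have q0 : 0 < t `^ (alpha + 1) by rewrite powR_gt0.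
  have q1 : t `^ (alpha + 1) <= 1.
    by rewrite -[leRHS](powRr0 t) ger_powR ?t0 ?(ltW t1) ?(ltW aS0).
  have te' : cT * t `^ (- (alpha + 1)) - cT < e / 2 by rewrite ltrBlDl.
  rewrite (_ : _ - _ = t `^ (alpha + 1) * (cT * t `^ (- (alpha + 1)) - cT)); last first.
    by rewrite powRN mulrBr mulrCA mulfV ?gt_eqF // mulr1; congr (_ - _); rewrite mulrC.
  have [h|h] := leP 0 (cT * t `^ (- (alpha + 1)) - cT).
    by apply: le_lt_trans te'; rewrite ler_piMl.
  by apply: lt_trans e20; rewrite pmulr_rlt0.
have [n hn] : exists n, EK * c1 - e / 2 < (\sum_(k < n) k%:R * p k) * c1.
  have c : (\sum_(k < n) k%:R * p k) * c1 @[n --> \oo] --> EK * c1.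
    by apply: cvgM; [exact: cvg_partial_mean (measurable_funPT K) hK|exact: cvg_cst].
  have lt1 : EK * c1 - e / 2 < EK * c1 by rewrite ltrBlDr ltrDl.
  have [n _ hn] := cvgr_gt _ c _ lt1.
  by exists n; exact: (hn n (leqnn n)).
have e't : 0 < 1 - t by rewrite subr_gt0.
have [N hN] := lln_lower X0_ge0 hident hindep b12 hm hM m0 e't.
have hS k := @tail_partial_sum _ _ _ _ _ _ X_ge0 hident hindep _ _ HH a1 _ hc1 k.
pose G x := t * tail P Lin (t^-1 * x) +
            \sum_(k < n) ((p k - tail P Lin (t^-1 * x)) * tail P (S k) x).
have GH : G x / H x @[x --> +oo] -->
    t * (cT * t^-1 `^ (- alpha)) + \sum_(k < n) ((p k - 0) * (k%:R * c1)).
  have -> : (fun x => G x / H x) = (fun x => t * (tail P Lin (t^-1 * x) / H x) +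
      \sum_(k < n) ((p k - tail P Lin (t^-1 * x)) * (tail P (S k) x / H x))).
    apply/funext => x; rewrite /G mulrDl mulr_suml -mulrA; congr (_ + _).
    by apply: eq_bigr => k _; rewrite mulrA.
  apply: cvgD; first by apply: cvgM; [exact: cvg_cst|exact: rv_tail_scale_cvg].
  apply: (@cvg_sum_ord n (fun k x => (p k - tail P Lin (t^-1 * x)) * (tail P (S k) x / H x))
    (fun k => (p k - 0) * (k%:R * c1))) => k.
  apply: cvgM => //; apply: cvgB; first exact: cvg_cst.
  by apply: (cvg_scale tV0); exact: (tail_cvg0 HH a0 hcT).
have lim_gt : cT + EK * c1 - e <
    t * (cT * t^-1 `^ (- alpha)) + \sum_(k < n) ((p k - 0) * (k%:R * c1)).
  have -> : cT + EK * c1 - e = (cT - e / 2) + (EK * c1 - e / 2) by field.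
  apply: ltrD.
    by rewrite powRV // opprK mulrA [t * cT]mulrC.
  rewrite (eq_bigr (fun k : 'I_n => k%:R * p k * c1)); last by move=> k _; ring.
  by rewrite -mulr_suml.
have hG := near_ge_of_cvg H0 GH lim_gt.
near=> x; apply: (@le_trans _ _ (G x)); first by near: x.
have x0 : 0 < x by near: x; exact: near_gt.
have xN : m * N%:R / (t^-1 - 1) <= x by near: x; exact: near_ge.
have tV1 : 0 < t^-1 - 1 by rewrite subr_gt0 invf_gt1.
move: xN; rewrite ler_pdivrMr // => xN.
set y := t^-1 * x.
have xy : x = t * y by rewrite /y mulrA mulfV ?mul1r // gt_eqF.
have mD z : measurable [set w | z < D w] by apply: measurable_gtr; exact: measurable_compound.
have mT z : measurable [set w | z < Lin w] by apply: measurable_gtr; exact: measurable_lin.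
have mT' z : measurable [set w | Lin w <= z] by apply: measurable_ler; exact: measurable_lin.
have mgt (z : R) : measurable [set u : R | z < u].
  exact: (measurable_gtr z (@measurable_id _ R setT)).
have mle (z : R) : measurable [set u : R | u <= z].
  exact: (measurable_ler z (@measurable_id _ R setT)).
have bad : pr P ([set w | D w <= x] `&` [set w | y < Lin w]) <= (1 - t) * tail P Lin y.
  apply: pr_level_sum; [|exact: mT|exact: ltW|].
    by apply: measurableI => //; apply: measurable_ler; exact: measurable_compound.
  move=> k.
  have mA : measurable ([set w | D w <= x] `&` [set w | y < Lin w] `&` [set w | K w = k]).
    apply: measurableI; last exact: measurable_level.
    by apply: measurableI => //; apply: measurable_ler; exact: measurable_compound.
  have eB : [set w | y < Lin w] `&` [set w | K w = k] =
      [set w | K w = k /\ [set u | y - m * k%:R < u] (X0 w)].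
    by apply/seteqP; split => w /= [] h1 h2; split => //; move: h1 h2 => /=;
      rewrite ltrBlDr => h1 h2; [rewrite -h2 | rewrite h1].
  rewrite eB.
  have [kN|Nk] := ltnP k N.
    rewrite [X in pr P X](_ : _ = set0); last first.
      apply/seteqP; split => w //= [[Dx yT] Kk].
      have S0 : 0 <= S (K w) w by exact: partial_sum_ge0.
      have kN' : m * (K w)%:R <= m * N%:R by rewrite ler_wpM2l ?(ltW m0) // ler_nat Kk ltnW.
      have : m * N%:R <= y - x by rewrite (le_trans xN) // mulrBr mulr1 mulrC.
      rewrite /= in S0; lra.
    by rewrite /pr measure0 mulr_ge0 ?pr_ge0 // ltW.
  apply: (@le_trans _ _ (pr P ([set w | K w = k /\ [set u | y - m * k%:R < u] (X0 w)] `&`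
      [set w | [set u | u <= (1 - (1 - t)) * m * k%:R] (S k w)]))).
    apply: le_pr => //.
      apply: measurableI; first exact: measurable_levelI.
      by apply: measurable_ler; exact: measurable_partial_sum.
    move=> w /= [[Dx yT] Kk]; rewrite Kk in Dx yT; split; first by split => //; rewrite ltrBlDr.
    rewrite subKr leNgt; apply/negP => hS'.
    have : x < X0 w + S k w.
      rewrite xy; apply: (@lt_le_trans _ _ (t * (X0 w + m * k%:R))); first by rewrite ltr_pM2l.
      rewrite mulrDr mulrA; apply: lerD; last exact: ltW.
      by rewrite ler_piMl // ltW.
    by rewrite ltNge Dx.
  rewrite pr_level_indep // mulrC ler_wpM2r ?pr_ge0 //.
  exact: hN.
rewrite {1}/tail.
apply: (@le_trans _ _ (pr P ([set w | x < D w] `&` [set w | y < Lin w]) +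
   pr P ([set w | x < D w] `&` [set w | Lin w <= y]))); last first.
  rewrite -lee_fin EFinD !pr_EFin //; [|exact: measurableI|exact: measurableI].
  rewrite -measureU //; [|exact: measurableI|exact: measurableI|].
    apply: le_measure; rewrite ?inE //; first by apply: measurableU; exact: measurableI.
    by move=> w [] [].
  apply/seteqP; split => w //= [[_ h1] [_ h2]].
  by move: h1; rewrite ltNge h2.
apply: lerD.
  have : tail P Lin y <= pr P ([set w | x < D w] `&` [set w | y < Lin w]) +
      pr P ([set w | D w <= x] `&` [set w | y < Lin w]).
    apply: le_pr_setU => //; [exact: measurableI| |].
      by apply: measurableI => //; apply: measurable_ler; exact: measurable_compound.
    by move=> w /= yT; have [h|h] := ltP x (D w); [left|right].
  rewrite -/y; lra.
pose E k := [set w | K w = k /\ [set u | u <= y - m * k%:R] (X0 w)] `&`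
  [set w | [set u | x < u] (S k w)].
have mE k : measurable (E k).
  apply: measurableI; first exact: measurable_levelI.
  by apply: measurable_gtr; exact: measurable_partial_sum.
apply: (@le_trans _ _ (\sum_(k < n) pr P (E k))).
  apply: ler_sum => k _; rewrite pr_level_indep // ler_wpM2r ?pr_ge0 //.
  rewrite lerBlDr; apply: le_pr_setU.
  - exact: measurable_level.
  - exact: measurable_levelI.
  - exact: mT.
  - move=> w /= Kk; have [h|h] := ltP y (Lin w); [by right|left].
    by split => //; rewrite lerBrDr -Kk.
apply: ge_pr_sum => //; first exact: measurableI.
- by move=> i j _ _ [w [[[/= <- _] _] [[/= <- _] _]]].
- move=> k w /= [[Kk hX] hS']; rewrite Kk; split; last by rewrite -lerBrDr.
  by apply: (lt_le_trans hS'); rewrite lerDr.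
Unshelve. all: by end_near. Qed.

Lemma compound_tail : tail P D x / H x @[x --> +oo] --> cT + EK * c1.
Proof.
have [_ H0 _] := HH.
by apply: (cvg_of_near_bounds H0) => e e0; [exact: compound_upper|exact: compound_lower].
Qed.

End CompoundSum.

(** * Norms on the plane *)

Section PlaneNorms.
Context {R : realType}.
Implicit Types (N : R * R -> R) (u v : R * R) (s t : R).

Lemma lipschitz_continuous (f : R -> R) L :
  (forall s t, `|f s - f t| <= L * `|s - t|) -> continuous f.
Proof.
move=> fL s; apply/cvgrPdist_le => e e0.
have L1 : 0 < `|L| + 1 by rewrite ltr_wpDl.
near=> t; apply: (le_trans (fL s t)).
apply: (@le_trans _ _ ((`|L| + 1) * `|s - t|)).
  by rewrite ler_wpM2r // (le_trans (ler_norm _)) // lerDl.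
rewrite mulrC -ler_pdivlMr //.
near: t; exists (e / (`|L| + 1)) => /=; first exact: divr_gt0.
by move=> z /= /ltW.
Unshelve. all: by end_near. Qed.

Lemma normN N v : is_norm N -> N (- v.1, - v.2) = N v.
Proof.
by case=> _ _ hs; have := hs (-1) v; rewrite !mulN1r normrN normr1 mul1r.
Qed.

Lemma norm_at0 N : is_norm N -> N (0, 0) = 0.
Proof. by case=> _ _ hs; have := hs 0 (0, 0); rewrite !mul0r normr0 mul0r. Qed.

Lemma norm_nonneg N v : is_norm N -> 0 <= N v.
Proof.
move=> hN; have [_ ht _] := hN.
have := ht v (- v.1, - v.2); rewrite /= !subrr (norm_at0 hN) (normN v hN).
by rewrite -mulr2n pmulrn_lge0.
Qed.

Lemma norm_pos N v : is_norm N -> v <> (0, 0) -> 0 < N v.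
Proof.
move=> hN v0; rewrite lt_neqAle norm_nonneg // andbT.
by apply/eqP => /esym; case: hN => + _ _ => /[apply].
Qed.

Lemma norm_le_coord N v : is_norm N -> N v <= `|v.1| * N (1, 0) + `|v.2| * N (0, 1).
Proof.
case=> _ ht hs; have := ht (v.1 * 1, v.1 * 0) (v.2 * 0, v.2 * 1).
rewrite /= !mulr0 !mulr1 addr0 add0r -surjective_pairing => /le_trans; apply.
by have := hs v.1 (1, 0); have := hs v.2 (0, 1); rewrite /= !mulr0 !mulr1 => -> ->.
Qed.

Lemma norm_lipschitz N (u1 s t : R) : is_norm N ->
  `|N (s, u1) - N (t, u1)| <= N (1, 0) * `|s - t|.
Proof.
move=> hN; have [_ ht hs] := hN.
have h (x y : R) : N (x, u1) - N (y, u1) <= N (1, 0) * `|x - y|.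
  have := ht (y, u1) ((x - y) * 1, (x - y) * 0).
  rewrite (hs (x - y) (1, 0)) /= mulr1 mulr0 addr0 addrC subrK => h.
  by rewrite lerBlDl mulrC.
rewrite ler_norml h andbT lerNl opprB distrC; exact: h.
Qed.

Lemma norm_swap N : is_norm N -> is_norm (fun v => N (v.2, v.1)).
Proof.
case=> h0 ht hs; split.
- by move=> [x y] /= /h0 [-> ->].
- by move=> v w /=; exact: (ht (v.2, v.1) (w.2, w.1)).
- by move=> c v; exact: (hs c (v.2, v.1)).
Qed.

(** Equivalence of norms: [t |-> N (t, 1)] is continuous, never 0, and large for
    large [t], so it has a positive lower bound; homogeneity does the rest. *)
Lemma coord2_le_norm N : is_norm N -> exists2 C, 0 < C & forall v, `|v.2| <= C * N v.
Proof.
move=> hN; have [_ ht hs] := hN.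
pose f t := N (t, 1).
have fc : continuous f by apply: lipschitz_continuous => s t; exact: norm_lipschitz.
have e1 : 0 < N (1, 0) by apply: norm_pos => // -[] /eqP; rewrite oner_eq0.
pose B := (N (0, 1) + 1) / N (1, 0).
have N01 : 0 <= N (0, 1) by exact: norm_nonneg.
have B0 : 0 <= B by rewrite divr_ge0 ?addr_ge0 // ltW.
have BB : - B <= B by lra.
have [c _ hc] := EVT_min BB (continuous_subspaceT fc).
have fc0 : 0 < f c by apply: norm_pos => // -[] _ /eqP; rewrite oner_eq0.
have fmin t : Num.min 1 (f c) <= f t.
  have [tB|tB] := boolP (t \in `[- B, B]); first by rewrite ge_min hc ?orbT.
  rewrite ge_min; apply/orP; left.
  have tB' : B < `|t| by move: tB; rewrite in_itv /= -ler_norml -ltNge.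
  have := ht (t, 1) (0, - 1); rewrite /= addr0 subrr.
  have -> : N (t, 0) = `|t| * N (1, 0) by rewrite -hs /= mulr1 mulr0.
  have -> : N (0, -1) = N (0, 1) by rewrite -(normN (0, 1) hN) /= oppr0.
  have : B * N (1, 0) < `|t| * N (1, 0) by rewrite ltr_pM2r.
  rewrite /B divfK ?gt_eqF // /f; lra.
have m0 : 0 < Num.min 1 (f c) by rewrite lt_min ltr01.
exists (Num.min 1 (f c))^-1; first by rewrite invr_gt0.
move=> v; rewrite mulrC ler_pdivlMr //.
have [->|v2] := eqVneq v.2 0; first by rewrite normr0 mul0r norm_nonneg.
have -> : N v = `|v.2| * f (v.1 / v.2).
  rewrite /f -hs /= mulr1 mulrC divfK //; by case: v v2.
by rewrite ler_wpM2l.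
Qed.

Lemma coord_le_norm N : is_norm N ->
  exists2 C, 0 < C & forall v, `|v.1| <= C * N v /\ `|v.2| <= C * N v.
Proof.
move=> hN; have [C1 C10 h1] := coord2_le_norm (norm_swap hN).
have [C2 C20 h2] := coord2_le_norm hN.
exists (C1 + C2); first by rewrite addr_gt0.
move=> v; have Nv := norm_nonneg v hN; split.
  have := h1 (v.2, v.1); rewrite /= -surjective_pairing => /le_trans; apply.
  by rewrite ler_wpM2r // lerDl ltW.
by apply: (le_trans (h2 v)); rewrite ler_wpM2r // lerDr ltW.
Qed.

End PlaneNorms.

(** * Regular variation read on the tail *)

Section RegularlyVaryingTails.
Context d (T : measurableType d) (R : realType) (P : probability T R).

Lemma regularly_varying_tail (Z : T -> R) alpha : measurable_fun setT Z ->
  regularly_varying P Z alpha -> rv_tail (tail P Z) alpha.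
Proof.
move=> mZ [a0 _ [L [mL Lpos Lsv] hL]].
have tE x : 0 < x -> tail P Z x = x `^ (- alpha) * L x by move=> x0; rewrite /tail /pr hL.
have tn := tail_nincr P mZ.
split=> //.
- move=> x; have [M [_ hM]] := Lpos.
  pose y := Num.max x (Num.max 1 (M + 1)).
  apply: (@lt_le_trans _ _ (tail P Z y)); last by apply: tn; rewrite le_max lexx.
  have y0 : 0 < y by rewrite !lt_max ltr01 orbT.
  rewrite tE // mulr_gt0 ?powR_gt0 //; apply: hM.
  by rewrite !lt_max ltrDl ltr01 !orbT.
- move=> t t0.
  rewrite -[X in _ --> X]mulr1.
  have h : t `^ (- alpha) * (L (t * x) / L x) @[x --> +oo] --> t `^ (- alpha) * 1.
    by apply: cvgM; [exact: cvg_cst | exact: Lsv].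
  apply: cvg_trans h; apply: near_eq_cvg; near=> x.
  have x0 : 0 < x by near: x; exact: near_gt.
  have Lx : 0 < L x by near: x.
  rewrite !tE ?mulr_gt0 // powRM ?(ltW t0) ?(ltW x0) //.
  have xa : x `^ (- alpha) != 0 by rewrite gt_eqF ?powR_gt0.
  by field; rewrite xa gt_eqF.
Unshelve. all: by end_near. Qed.

Lemma tail_regularly_varying (Z : T -> R) alpha : measurable_fun setT Z ->
  0 < alpha -> {ae P, forall w, 0 <= Z w} -> rv_tail (tail P Z) alpha ->
  regularly_varying P Z alpha.
Proof.
move=> mZ a0 Z0 [tm tpos trv]; split=> //.
pose L x := x `^ alpha * tail P Z x.
exists L; last first.
  move=> x x0; rewrite /L mulrA powRN mulVf ?gt_eqF ?powR_gt0 // mul1r.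
  by rewrite pr_EFin //; exact: measurable_gtr.
split.
- apply: measurable_funTS; apply: measurable_funM; first exact: measurable_powR.
  by apply: nonincreasing_measurable => // x y; exact: tm.
- by near=> x; rewrite /L mulr_gt0 // powR_gt0 //; near: x; exact: near_gt.
- move=> t t0.
  have h : t `^ alpha * (tail P Z (t * x) / tail P Z x) @[x --> +oo] --> t `^ alpha * t `^ (- alpha).
    by apply: cvgM; [exact: cvg_cst | exact: trv].
  rewrite powRN mulfV ?gt_eqF ?powR_gt0 // in h.
  apply: cvg_trans h; apply: near_eq_cvg; near=> x.
  have x0 : 0 < x by near: x; exact: near_gt.
  rewrite /L powRM ?(ltW t0) ?(ltW x0) //.
  have xa : x `^ alpha != 0 by rewrite gt_eqF ?powR_gt0.
  by field; rewrite xa gt_eqF.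
Unshelve. all: by end_near. Qed.

End RegularlyVaryingTails.

(** * Tails of linear functionals of a regularly varying vector *)

Section Clamp.
Context {R : realType}.
Implicit Types x : R.

(** The piecewise linear step, 0 on the negative half-line and 1 from 1 on,
    written with absolute values so that its continuity and measurability are
    those of the norm. *)
Definition clamp (x : R) : R := (`|x| - `|x - 1| + 1) / 2.

Lemma clamp_ge0 x : 0 <= clamp x.
Proof.
by have := ler_normB x 1; rewrite normr1 /clamp; lra.
Qed.

Lemma clamp_le1 x : clamp x <= 1.
Proof.
by have := ler_normD (x - 1) 1; rewrite subrK normr1 /clamp; lra.
Qed.

Lemma clamp_neg x : x <= 0 -> clamp x = 0.
Proof.
move=> x0; rewrite /clamp ler0_norm // ler0_norm; last lra.
by field.
Qed.

Lemma clamp_big x : 1 <= x -> clamp x = 1.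
Proof.
move=> x1; rewrite /clamp ger0_norm; last lra.
rewrite ger0_norm; last lra.
by field.
Qed.

Lemma continuous_clamp : continuous (clamp : R -> R).
Proof.
move=> x; apply: cvgM; last exact: cvg_cst.
apply: cvgD; last exact: cvg_cst.
apply: cvgB; apply: cvg_norm; first exact: cvg_id.
by apply: cvgB; [exact: cvg_id | exact: cvg_cst].
Qed.

Lemma measurable_clamp : measurable_fun setT (clamp : R -> R).
Proof. by apply: continuous_measurable_fun; exact: continuous_clamp. Qed.

End Clamp.

Section VectorTails.
Context d (T : measurableType d) (R : realType) (P : probability T R).
Context (X0 : {RV P >-> R}) (K : {RV P >-> nat}) (X0_ge0 : forall w, 0 <= X0 w).
Context (N : R * R -> R) (hN : is_norm N) (alpha : R).

Local Notation V := (fun w => (X0 w, (K w)%:R : R)).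
Local Notation W := (N \o V).

Lemma measurable_norm_vector : measurable_fun setT W.
Proof.
move=> _ Y mY; rewrite setTI.
have -> : W @^-1` Y = \bigcup_k ([set w | K w = k] `&` (fun w => N (X0 w, k%:R)) @^-1` Y).
  apply/seteqP; split => w /=.
    by move=> h; exists (K w).
  by move=> [k _ /= [->]].
apply: bigcup_measurable => k _; apply: measurableI; first exact: measurable_level.
have mNk : measurable_fun setT (fun w => N (X0 w, k%:R)).
  apply: (@measurableT_comp _ _ _ _ _ _ (fun t => N (t, k%:R))) => //.
  apply: continuous_measurable_fun.
  by apply: lipschitz_continuous => s t; exact: norm_lipschitz.
by have := mNk measurableT _ mY; rewrite setTI.
Qed.

Context (hW : regularly_varying P W alpha).
Local Notation H := (tail P W).

Let a0 : 0 < alpha. Proof. by case: hW. Qed.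
Let HH : rv_tail H alpha.
Proof. by apply: regularly_varying_tail => //; exact: measurable_norm_vector. Qed.

Context (a : nat -> R) (mu : {measure set (R * R) -> \bar R}).
Context (ha : (n%:R%:E * P [set w | (a n < N (V w))%R])%E @[n --> \oo] --> 1%:E).
Context (hmu : radon_punctured mu).
Context (hvague : vague_cvg_punctured
   (fun n => scaled_law P n (fun w => ((a n)^-1 * (V w).1, (a n)^-1 * (V w).2))) mu).

Lemma norming_tail : n%:R * H (a n) @[n --> \oo] --> (1 : R).
Proof.
apply: (cvg_trans _ (fine_cvg ha)); apply: near_eq_cvg; near=> n.
rewrite /= fineM // fin_num_measure //.
by apply: measurable_gtr; exact: measurable_norm_vector.
Unshelve. all: by end_near. Qed.

Lemma norming_pinfty (A : R) : \forall n \near \oo, A < a n.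
Proof.
have [Hm H0 _] := HH.
near=> n; rewrite ltNge; apply/negP => aA.
have h1 : n%:R * H (a n) < 2.
  by near: n; apply: cvgr_lt norming_tail _ _; rewrite ltr1n.
have h2 : 2 / H A < n%:R by near: n; exact: nbhs_infty_gtr.
move: h2; rewrite ltr_pdivrMr // => /lt_le_trans /(_ (ler_wpM2l _ (Hm _ _ aA))).
by move=> /(_ (ler0n _ _)) /lt_trans /(_ h1); rewrite ltxx.
Unshelve. all: by end_near. Qed.

Context (u v : R) (u0 : 0 <= u) (v0 : 0 <= v).
Local Notation Z := (fun w => u * X0 w + v * (K w)%:R).
Local Notation F := (tail P Z).

Let mZ : measurable_fun setT Z. Proof. exact: measurable_linear_comb. Qed.

Lemma linear_comb_le_norm : exists2 C, 0 < C & forall w, Z w <= C * W w.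
Proof.
have [C C0 hC] := coord_le_norm hN.
exists ((u + v + 1) * C); first by rewrite mulr_gt0 // ltr_wpDl // addr_ge0.
move=> w; have [h1 h2] := hC (V w); rewrite /= in h1 h2.
have CN : 0 <= C * W w by rewrite mulr_ge0 ?(ltW C0) //; exact: norm_nonneg.
rewrite ger0_norm // in h1; rewrite ger0_norm // in h2.
rewrite -mulrA 2!mulrDl mul1r; apply: (@le_trans _ _ (u * (C * W w) + v * (C * W w))).
  by apply: lerD; rewrite ler_wpM2l.
by rewrite lerDl.
Qed.

Local Notation ell := (fun z : R * R => u * z.1 + v * z.2).

Lemma continuous_ell : continuous ell.
Proof.
by move=> z; apply: cvgD; apply: cvgM;
  [exact: cvg_cst | exact: cvg_fst | exact: cvg_cst | exact: cvg_snd].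
Qed.

Lemma measurable_ell : measurable_fun setT ell.
Proof.
by apply: measurable_funD; apply: measurable_funM.
Qed.

(** One test function, vanishing where [u z.1 + v z.2 <= 1] and equal to 1 where
    it is at least [eta]. Being continuous, it cannot be the indicator of a half
    plane, hence the two different thresholds in the bounds. *)
Lemma tail_along_norming (eta : R) : 1 < eta -> exists I : R, forall e, 0 < e ->
  \forall n \near \oo, n%:R * F (eta * a n) <= I + e /\ I - e <= n%:R * F (a n).
Proof.
move=> eta1; have e10 : 0 < eta - 1 by rewrite subr_gt0.
pose g z := clamp ((ell z - 1) / (eta - 1)).
have g0 z : 0 <= g z by exact: clamp_ge0.
have g1 z : g z <= 1 by exact: clamp_le1.
have gc : continuous g.
  move=> z; apply: (@continuous_comp _ _ _ (fun z => (ell z - 1) / (eta - 1)) clamp z); last exact: continuous_clamp.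
  apply: cvgM; last exact: cvg_cst.
  by apply: cvgB; [exact: continuous_ell | exact: cvg_cst].
have gsupp z : g z != 0 -> 1 < ell z.
  apply: contraNT; rewrite -leNgt => h; apply/eqP/clamp_neg.
  by rewrite mulr_le0_ge0 ?subr_le0 // invr_ge0 ltW.
have away : bounded_away [set z | 1 < ell z].
  move=> /(_ [set z | ell z < 1]) [].
    apply: (@continuous_ell (0, 0) [set r : R | r < 1]).
    by apply: lt_nbhsl; rewrite /= !mulr0 addr0.
  by move=> z [/= h1 h2]; have := lt_trans h1 h2; rewrite ltxx.
have awayg : bounded_away [set z | g z != 0].
  by apply: contra_not away; apply: closure_subset.
have mg : measurable_fun setT g.
  apply: (measurableT_comp measurable_clamp).
  apply: measurable_funM => //; apply: measurable_funB => //.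
  exact: measurable_ell.
have gmuoo : (\int[mu]_z (g z)%:E < +oo)%E.
  have mS : measurable [set z | 1 < ell z].
    have := measurable_ell measurableT (measurable_itv `]1, +oo[).
    by rewrite setTI; congr measurable; apply/seteqP; split => z /=; rewrite in_itv /= andbT.
  apply: le_lt_trans (hmu.2 _ mS away).
  rewrite -[X in (_ <= mu X)%E]setIT -integral_indic //.
  apply: ge0_le_integral => //.
  - by move=> z _; rewrite lee_fin.
  - exact/measurable_EFinP.
  - exact/measurable_EFinP/measurable_indic.
  - move=> z _; rewrite lee_fin indicE.
    have [/gsupp h|/negPn/eqP ->] := boolP (g z != 0); last by [].
    by rewrite mem_set.
exists (fine (\int[mu]_z (g z)%:E)) => e e0.
have lim := hvague gc g0 (ex_intro _ 1 g1) awayg.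
rewrite -[X in _ --> X]fineK in lim; last first.
  by rewrite ge0_fin_numE // integral_ge0 // => z _; rewrite lee_fin.
have /fine_cvgP [_ /cvgrPdist_le /(_ _ e0) [n1 _ hn1]] := lim.
near=> n.
have n1n : (n1 <= n)%N by near: n; exact: nbhs_infty_ge.
have an : 0 < a n by near: n; exact: norming_pinfty.
pose Vn w := ((a n)^-1 * X0 w, (a n)^-1 * (K w)%:R : R).
have mVn : measurable_fun setT Vn.
  apply: measurable_fun_pair; apply: measurable_funM => //; exact: measurable_natr.
pose Vn' : {RV P >-> (R * R)%type} :=
  HB.pack_for {RV P >-> (R * R)%type} Vn (isMeasurableFun.Build _ _ _ _ _ mVn).
have mgE : measurable_fun setT (fun z => (g z)%:E) by exact/measurable_EFinP.
have gE0 z : (0 <= (g z)%:E)%E by rewrite lee_fin.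
have intE : (\int[scaled_law P n Vn]_z (g z)%:E = n%:R%:E * \int[P]_w (g (Vn w))%:E)%E.
  transitivity (\int[mscale (NngNum (ler0n R n)) (distribution P Vn')]_z (g z)%:E)%E; first by [].
  transitivity (n%:R%:E * \int[distribution P Vn']_z (g z)%:E)%E.
    exact: (ge0_integral_mscale (distribution P Vn') measurableT (NngNum (ler0n R n)) mgE
      (fun z _ => gE0 z)).
  congr (_ * _)%E; apply: (@ge0_integral_distribution _ _ _ _ _ P Vn' (fun z => (g z)%:E)) => //.
have mgV : measurable_fun setT (fun w => (g (Vn w))%:E).
  by apply/measurable_EFinP; exact: (measurableT_comp mg mVn).
have ellV w : ell (Vn w) = Z w / a n by rewrite /Vn /=; ring.
have lowb : ((F (eta * a n))%:E <= \int[P]_w (g (Vn w))%:E)%E.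
  have mS := measurable_gtr (eta * a n) mZ.
  rewrite pr_EFin // -[X in (P X <= _)%E]setIT -integral_indic //.
  apply: ge0_le_integral => //.
  - exact/measurable_EFinP/measurable_indic.
  - move=> w _; rewrite lee_fin indicE; case: (boolP (w \in _)) => // /set_mem /= h.
    rewrite /g clamp_big // ellV ler_pdivlMr // mul1r lerD2r ler_pdivlMr //.
    exact: ltW.
have upb : (\int[P]_w (g (Vn w))%:E <= (F (a n))%:E)%E.
  have mS := measurable_gtr (a n) mZ.
  rewrite pr_EFin // -[X in (_ <= P X)%E]setIT -integral_indic //.
  apply: ge0_le_integral => //.
  - exact/measurable_EFinP/measurable_indic.
  - move=> w _; rewrite lee_fin indicE.
    have [/gsupp h|/negPn/eqP ->] := boolP (g (Vn w) != 0); last by [].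
    by rewrite mem_set //=; move: h; rewrite ellV ltr_pdivlMr // mul1r.
have fin : (\int[P]_w (g (Vn w))%:E)%E \is a fin_num.
  rewrite ge0_fin_numE; first by apply: le_lt_trans upb _; rewrite ltry.
  by apply: integral_ge0 => w _; rewrite lee_fin.
move: lowb upb; rewrite -(fineK fin) !lee_fin => lowb upb.
set q := fine (\int[P]_w (g (Vn w))%:E)%E in lowb upb.
have close : `|fine (\int[mu]_z (g z)%:E)%E - n%:R * q| <= e.
  have -> : n%:R * q = fine (\int[scaled_law P n Vn]_z (g z)%:E)%E.
    by rewrite intE fineM.
  exact: (hn1 n n1n).
move: close; rewrite ler_distlC => /andP[h1 h2]; split.
  by apply: le_trans h2; rewrite ler_wpM2l.
by apply: (le_trans h1); rewrite ler_wpM2l.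
Unshelve. all: by end_near. Qed.

(** Chosen so that [n H x] tends to 1; then [a n] is asymptotic to [x], and a
    statement along the norming sequence becomes one for real [x]. *)
Definition rank_of (x : R) : nat := (Num.truncn (H x)^-1).+1.

Lemma near_rank (A : nat -> Prop) : (\forall n \near \oo, A n) ->
  \forall x \near +oo, A (rank_of x).
Proof.
move=> [n0 _ hA]; have [_ H0 _] := HH.
have n0V : 0 < n0.+1%:R^-1 :> R by rewrite invr_gt0 ltr0n.
near=> x; apply: hA; rewrite /= /rank_of leqW //.
have hx : H x <= n0.+1%:R^-1.
  by apply/ltW; near: x; exact: (cvgr_lt _ (rv_tail_cvg0 HH a0) _ n0V).
rewrite truncn_ge_nat ?invr_ge0 ?(ltW (H0 _)) //.
apply: (@le_trans _ _ n0.+1%:R); first by rewrite ler_nat.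
have n00 : 0 < n0.+1%:R :> R by rewrite ltr0n.
by rewrite -[leLHS]invrK lef_pV2 ?posrE ?invr_gt0.
Unshelve. all: by end_near. Qed.

Lemma rank_bounds x : 1 <= (rank_of x)%:R * H x <= 1 + H x.
Proof.
have [_ H0 _] := HH.
have iH0 : 0 <= (H x)^-1 by rewrite invr_ge0 ltW.
have /andP[h1 h2] := truncn_itv iH0.
have hh : (H x)^-1 * H x = 1 by rewrite mulVf // gt_eqF.
apply/andP; split.
  by rewrite -[leLHS]hh ler_wpM2r ?(ltW (H0 _)) // ltW.
have -> : 1 + H x = ((H x)^-1 + 1) * H x by rewrite mulrDl hh mul1r.
by rewrite ler_wpM2r ?(ltW (H0 _)) // /rank_of -natr1 lerD2r.
Qed.

(** [H (a n)] and [H x] are both equivalent to [1 / n]; if [a n] and [x] differed by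
    the factor [eta], regular variation would separate these two values. *)
Lemma norming_rank (eta : R) : 1 < eta ->
  \forall x \near +oo, eta^-1 * x <= a (rank_of x) <= eta * x.
Proof.
move=> eta1; have [Hm H0 HRV] := HH.
have eta0 : 0 < eta by apply: lt_trans eta1.
have etaV0 : 0 < eta^-1 by rewrite invr_gt0.
pose Q := eta `^ alpha.
have Q1 : 1 < Q.
  by rewrite -[ltLHS](powRr0 eta) /Q /powR gt_eqF // ltr_expR mul0r mulr_gt0 // ln_gt0.
have Q0 : 0 < Q by apply: lt_trans Q1.
have QV1 : Q^-1 < 1 by rewrite invf_lt1.
have lo : H (eta * x) / H x @[x --> +oo] --> Q^-1.
  by rewrite /Q -powRN; exact: HRV.
have hi : H (eta^-1 * x) / H x @[x --> +oo] --> Q.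
  by have := HRV _ etaV0; rewrite powRV // opprK.
have lo2 : (1 + H x) * (H (eta * x) / H x) @[x --> +oo] --> (1 + 0) * Q^-1.
  apply: cvgM => //; apply: cvgD; first exact: cvg_cst.
  exact: rv_tail_cvg0 HH a0.
rewrite addr0 mul1r in lo2.
pose ql := (Q^-1 + 1) / 2; pose qh := (1 + Q) / 2.
have qlQ : Q^-1 < ql by rewrite /ql; lra.
have ql1 : ql < 1 by rewrite /ql; lra.
have qhQ : qh < Q by rewrite /qh; lra.
have qh1 : 1 < qh by rewrite /qh; lra.
have nl : \forall x \near +oo, ql < (rank_of x)%:R * H (a (rank_of x)).
  exact: (near_rank (cvgr_gt _ norming_tail _ ql1)).
have nh : \forall x \near +oo, (rank_of x)%:R * H (a (rank_of x)) < qh.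
  exact: (near_rank (cvgr_lt _ norming_tail _ qh1)).
near=> x.
have nlx : ql < (rank_of x)%:R * H (a (rank_of x)) by near: x.
have nhx : (rank_of x)%:R * H (a (rank_of x)) < qh by near: x.
have lox : (1 + H x) * (H (eta * x) / H x) < ql by near: x; exact: (cvgr_lt _ lo2 _ qlQ).
have hix : qh < H (eta^-1 * x) / H x by near: x; exact: (cvgr_gt _ hi _ qhQ).
have /andP[i1 i2] := rank_bounds x.
have r0 z : 0 <= H z / H x by rewrite divr_ge0 // ltW.
have iE z : (rank_of x)%:R * H z = (rank_of x)%:R * H x * (H z / H x).
  by field; rewrite gt_eqF.
rewrite !leNgt; apply/andP; split; apply/negP => h.
- have : (rank_of x)%:R * H (eta^-1 * x) <= (rank_of x)%:R * H (a (rank_of x)).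
    by rewrite ler_wpM2l // Hm // ltW.
  rewrite leNgt => /negP; apply; apply: (lt_trans nhx); apply: (lt_le_trans hix).
  by rewrite iE ler_peMl.
- have : (rank_of x)%:R * H (a (rank_of x)) <= (rank_of x)%:R * H (eta * x).
    by rewrite ler_wpM2l // Hm // ltW.
  rewrite leNgt => /negP; apply; apply: le_lt_trans _ (lt_trans lox nlx).
  by rewrite iE ler_wpM2r.
Unshelve. all: by end_near. Qed.

Lemma tail_linear_le : exists2 C, 0 < C & forall x, F x <= H (C^-1 * x).
Proof.
have [C C0 hC] := linear_comb_le_norm; exists C => // x.
apply: le_tail => //; first exact: measurable_norm_vector.
by move=> w xZ; rewrite mulrC ltr_pdivrMr // mulrC; exact: lt_le_trans (hC w).
Qed.

Lemma tail_linear_cvg0 : F x @[x --> +oo] --> 0.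
Proof.
have [C C0 hC] := tail_linear_le.
have CV0 : 0 < C^-1 by rewrite invr_gt0.
apply: (squeeze_cvgr (f := fun=> 0) (h := fun x => H (C^-1 * x))).
- by apply: nearW => x; rewrite pr_ge0 hC.
- exact: cvg_cst.
- by apply: (cvg_scale CV0); exact: rv_tail_cvg0 HH a0.
Qed.

Lemma tail_scale_bounds (eta : R) : 1 < eta -> exists I : R, forall e, 0 < e ->
  \forall x \near +oo, F (eta ^+ 2 * x) <= (I + e) * H x /\
                       (I - e) * H x <= F (eta^-1 * x).
Proof.
move=> eta1; have [I hI] := tail_along_norming eta1.
have [Hm H0 HRV] := HH.
have eta0 : 0 < eta by apply: lt_trans eta1.
have etaV0 : 0 < eta^-1 by rewrite invr_gt0.
exists I => e e0; have e20 : 0 < e / 2 by rewrite divr_gt0.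
have hI2 := near_rank (hI _ e20).
near=> x.
have [h1 h2] : (rank_of x)%:R * F (eta * a (rank_of x)) <= I + e / 2 /\
   I - e / 2 <= (rank_of x)%:R * F (a (rank_of x)) by near: x.
have /andP[b1 b2] : eta^-1 * x <= a (rank_of x) <= eta * x by near: x; exact: norming_rank.
have F1 : F (eta^-1 * x) <= e / 2.
  near: x; have := cvg_scale etaV0 tail_linear_cvg0.
  by move/cvgr_lt => /(_ _ e20); apply: filterS => x /ltW.
have /andP[i1 i2] := rank_bounds x.
have Hx := H0 x.
have Fn : forall y z, y <= z -> F z <= F y := tail_nincr P mZ.
have n0 : 0 <= (rank_of x)%:R :> R by [].
split.
- have Fa : F (eta ^+ 2 * x) <= F (eta * a (rank_of x)).
    by apply: Fn; rewrite expr2 -mulrA ler_pM2l.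
  have F0 : 0 <= F (eta ^+ 2 * x) by exact: pr_ge0.
  have : (rank_of x)%:R * F (eta ^+ 2 * x) <= I + e / 2.
    by apply: le_trans h1; rewrite ler_wpM2l.
  rewrite -(ler_pM2r Hx) => h; apply: (@le_trans _ _ ((rank_of x)%:R * F (eta ^+ 2 * x) * H x)).
    by rewrite [leRHS]mulrAC ler_peMl.
  apply: (le_trans h); rewrite ler_wpM2r ?(ltW Hx) //; lra.
- have Fa : F (a (rank_of x)) <= F (eta^-1 * x) by exact: Fn.
  have F0 : 0 <= F (eta^-1 * x) by exact: pr_ge0.
  have : I - e / 2 <= (rank_of x)%:R * F (eta^-1 * x).
    by apply: (le_trans h2); rewrite ler_wpM2l.
  rewrite -(ler_pM2r Hx) [leRHS]mulrAC => h.
  have h3 : (I - e / 2) * H x <= (1 + H x) * F (eta^-1 * x).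
    by apply: (le_trans h); rewrite ler_wpM2r.
  have h4 : H x * F (eta^-1 * x) <= H x * (e / 2) by rewrite ler_pM2l.
  nra.
Unshelve. all: by end_near. Qed.

(** The two bounds at thresholds [eta^2 x] and [x / eta] are brought back to [x] by
    regular variation of [H], at the price of factors [eta^(2 alpha)] and
    [eta^(- alpha)]. As [eta] tends to 1 they pinch the ratio: it is Cauchy. *)
Lemma linear_tail_cvg : exists c : R, F x / H x @[x --> +oo] --> c.
Proof.
have [Hm H0 HRV] := HH.
have [C C0 hC] := tail_linear_le.
have CV0 : 0 < C^-1 by rewrite invr_gt0.
(* a bound on every constant [I] below, by comparison of [F] with [H] *)
pose B := 2 * C `^ alpha + 2.
have B0 : 0 < B by rewrite ltr_wpDl // mulr_ge0 // powR_ge0.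
suff : cauchy (F x / H x @[x --> +oo]).
  by move/cauchy_cvg => h; exists (lim (F x / H x @[x --> +oo])).
apply: cauchy_exP => e e0.
pose t := Num.min 1 (e / (12 * B)).
have t0 : 0 < t by rewrite lt_min ltr01 divr_gt0 // mulr_gt0.
have t1 : t <= 1 by rewrite ge_min lexx.
have tB : t * B <= e / 12.
  have : t <= e / (12 * B) by rewrite ge_min lexx orbT.
  by rewrite -(ler_pM2r B0) invfM mulrA divfK // gt_eqF.
pose s := 1 + t; have s1 : 1 < s by rewrite ltrDl.
have s0 : 0 < s by apply: lt_trans s1.
pose eta := s `^ alpha^-1.
have eta1 : 1 < eta.
  rewrite -[ltLHS](powRr0 s) /eta /powR gt_eqF // ltr_expR mul0r.
  by rewrite mulr_gt0 ?invr_gt0 // ln_gt0.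
have eta0 : 0 < eta by apply: lt_trans eta1.
have etaV0 : 0 < eta^-1 by rewrite invr_gt0.
have etaa : eta `^ alpha = s by rewrite /eta -powRrM mulVf ?gt_eqF // powRr1 // ltW.
have [I hI] := tail_scale_bounds eta1.
pose e' := Num.min 1 (e / 16).
have e'0 : 0 < e' by rewrite lt_min ltr01 divr_gt0.
have e'1 : e' <= 1 by rewrite ge_min lexx.
have e'e : e' <= e / 16 by rewrite ge_min lexx orbT.
have IB : I <= B.
  have l1 : H (C^-1 * (eta^-1 * x)) / H x @[x --> +oo] --> C `^ alpha * s.
    have -> : (fun x => H (C^-1 * (eta^-1 * x)) / H x) =
        (fun x => H ((C^-1 * eta^-1) * x) / H x) by apply/funext => x; rewrite mulrA.
    have := HRV (C^-1 * eta^-1); rewrite mulr_gt0 // => /(_ isT).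
    by rewrite powRM ?(ltW CV0) ?(ltW etaV0) // !powRV // opprK etaa.
  have l2 : C `^ alpha * s < C `^ alpha * s + 1 by rewrite ltrDl.
  have near1 := near_le_of_cvg H0 l1 l2.
  have near2 := hI _ e'0.
  near +oo_R => x.
  have h1 : H (C^-1 * (eta^-1 * x)) <= (C `^ alpha * s + 1) * H x by near: x.
  have [_ h2] : F (eta ^+ 2 * x) <= (I + e') * H x /\
                (I - e') * H x <= F (eta^-1 * x) by near: x.
  have := le_trans h2 (le_trans (hC _) h1); rewrite ler_pM2r // => h3.
  have : C `^ alpha * s <= C `^ alpha * 2 by rewrite ler_wpM2l ?powR_ge0 // /s; lra.
  by rewrite /B; lra.
exists I.
have etaV20 : 0 < eta ^- 2 by rewrite invr_gt0 exprn_gt0.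
have lu : H (eta ^- 2 * x) / H x @[x --> +oo] --> s ^+ 2.
  have e2 : (eta ^+ 2) `^ alpha = s ^+ 2.
    by rewrite -(powR_mulrn 2 (ltW eta0)) powRAC etaa powR_mulrn ?(ltW s0).
  by have := HRV _ etaV20; rewrite powRV ?exprn_gt0 // opprK e2.
have ll : H (eta * x) / H x @[x --> +oo] --> s^-1.
  by have := HRV _ eta0; rewrite powRN etaa.
have gu : (I + e') * (H (eta ^- 2 * x) / H x) @[x --> +oo] --> (I + e') * s ^+ 2.
  by apply: cvgM => //; exact: cvg_cst.
have gl : (I - e') * (H (eta * x) / H x) @[x --> +oo] --> (I - e') * s^-1.
  by apply: cvgM => //; exact: cvg_cst.
have bu : (I + e') * s ^+ 2 < I + e.
  have -> : s ^+ 2 = 1 + t * (2 + t) by rewrite /s; ring.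
  have h1 : (I + e') * (t * (2 + t)) <= (B + 1) * (t * (2 + t)).
    by rewrite ler_wpM2r ?mulr_ge0 ?addr_ge0 ?(ltW t0) //; lra.
  have h2 : t * (2 + t) <= 3 * t by rewrite mulrC ler_wpM2r ?(ltW t0) //; lra.
  have h3 : (B + 1) * (t * (2 + t)) <= (B + 1) * (3 * t).
    by rewrite ler_wpM2l // addr_ge0 // ltW.
  have h4 : t <= t * B by rewrite ler_peMr ?(ltW t0) // /B; have := powR_ge0 C alpha; lra.
  lra.
have bl : I - e < (I - e') * s^-1.
  rewrite ltr_pdivlMr // /s.
  have h1 : I * t <= B * t by rewrite ler_wpM2r // ltW.
  have h2 : 0 <= e * t by rewrite mulr_ge0 // ltW.
  nra.
have nu := near_scale etaV20 (hI _ e'0).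
have nl := near_scale eta0 (hI _ e'0).
rewrite /= near_simpl; near=> x.
rewrite /ball /= distrC ltr_distl; apply/andP; split.
- apply: (@lt_le_trans _ _ ((I - e') * (H (eta * x) / H x))).
    by near: x; exact: (cvgr_gt _ gl _ bl).
  rewrite mulrA ler_pM2r ?invr_gt0 //.
  have [_] : F (eta ^+ 2 * (eta * x)) <= (I + e') * H (eta * x) /\
                (I - e') * H (eta * x) <= F (eta^-1 * (eta * x)) by near: x.
  by rewrite mulKf // gt_eqF.
- apply: (@le_lt_trans _ _ ((I + e') * (H (eta ^- 2 * x) / H x))).
    rewrite mulrA ler_pM2r ?invr_gt0 //.
    have [+ _] : F (eta ^+ 2 * (eta ^- 2 * x)) <= (I + e') * H (eta ^- 2 * x) /\
                (I - e') * H (eta ^- 2 * x) <= F (eta^-1 * (eta ^- 2 * x)) by near: x.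
    by rewrite mulVKf // gt_eqF // exprn_gt0.
  by near: x; exact: (cvgr_lt _ gu _ bu).
Unshelve. all: by end_near. Qed.

End VectorTails.

(** * Domination of moments *)

Section DominatedMoments.
Context d (T : measurableType d) (R : realType) (P : probability T R).
Implicit Types Z W : T -> R.

Lemma moment_dominated Z W C b : measurable_fun setT Z -> measurable_fun setT W ->
  (forall w, 0 <= Z w) -> (forall w, 0 <= W w) -> 0 <= C -> 0 <= b ->
  (forall w, Z w <= C * W w) -> (\int[P]_w (W w `^ b)%:E < +oo)%E ->
  (\int[P]_w (Z w `^ b)%:E < +oo)%E.
Proof.
move=> mZ mW Z0 W0 C0 b0 ZW Woo.
have mpow (U : T -> R) : measurable_fun setT U -> measurable_fun setT (fun w => (U w `^ b)%:E).
  by move=> mU; apply/measurable_EFinP; exact: (measurableT_comp (measurable_powR b)).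
apply: (@le_lt_trans _ _ (\int[P]_w ((C `^ b)%:E * (W w `^ b)%:E))%E).
  apply: ge0_le_integral => //.
  - by move=> w _; rewrite lee_fin powR_ge0.
  - exact: mpow.
  - by apply: emeasurable_funM => //; exact: mpow.
  - move=> w _; rewrite -EFinM lee_fin -powRM // ge0_ler_powR ?nnegrE //.
    exact: mulr_ge0.
rewrite ge0_integralZl_EFin ?powR_ge0 //; last 2 first.
- by move=> w _; rewrite lee_fin powR_ge0.
- exact: mpow.
by rewrite lte_mul_pinfty ?lee_fin ?powR_ge0.
Qed.

Lemma mean_of_moment Z b : measurable_fun setT Z -> (forall w, 0 <= Z w) -> 1 <= b ->
  (\int[P]_w (Z w `^ b)%:E < +oo)%E -> (\int[P]_w (Z w)%:E < +oo)%E.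
Proof.
move=> mZ Z0 b1 Zoo.
have mpow : measurable_fun setT (fun w => (Z w `^ b)%:E).
  by apply/measurable_EFinP; exact: (measurableT_comp (measurable_powR b)).
apply: (@le_lt_trans _ _ (\int[P]_w (1 + (Z w `^ b)%:E))%E).
  apply: ge0_le_integral => //.
  - by move=> w _; rewrite lee_fin.
  - exact/measurable_EFinP.
  - exact: emeasurable_funD.
  - move=> w _; rewrite -EFinD lee_fin; have [Z1|Z1] := leP (Z w) 1.
      by apply: (le_trans Z1); rewrite lerDl powR_ge0.
    by apply: (le_trans (le1r_powR (ltW Z1) b1)); rewrite lerDr.
rewrite ge0_integralD //; last by move=> w _; rewrite lee_fin powR_ge0.
rewrite integral_one.
by rewrite lte_add_pinfty // ltry.
Qed.

End DominatedMoments.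

(** * Positive parts of the marks *)

Section PositivePart.
Context d (T : measurableType d) (R : realType) (P : probability T R).
Context (X0 : {RV P >-> R}) (X0_ge0 : forall w, 0 <= X0 w).
Context (Xs : nat -> {RV P >-> R}) (K : {RV P >-> nat}).

Definition pos_part (x : R) : R := Num.max 0 x.

Lemma measurable_pos_part : measurable_fun setT pos_part.
Proof. exact: measurable_maxr. Qed.

Lemma measurable_pos_part_comp j : measurable_fun setT (pos_part \o Xs j).
Proof. by apply: (measurableT_comp measurable_pos_part). Qed.

(** Marks with the law of a nonnegative variable are nonnegative only almost
    surely. Their positive parts have the same law and the same independence,
    and make all partial sums nonnegative everywhere. *)
Definition pos_part_rv j : {RV P >-> R} :=
  HB.pack_for {RV P >-> R} (pos_part \o Xs j) (isMeasurableFun.Build _ _ _ _ _ (measurable_pos_part_comp j)).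

Lemma pos_part_rv_ge0 j w : 0 <= pos_part_rv j w.
Proof. by rewrite /= /pos_part le_max lexx. Qed.

Lemma measurable_pos_part_preimage (B : set R) : measurable B -> measurable (pos_part @^-1` B).
Proof. by move=> mB; rewrite -[X in measurable X]setTI; exact: measurable_pos_part. Qed.

Lemma pos_part_rv_ident : (forall j, eq_in_law P P (Xs j) X0) ->
  forall j, eq_in_law P P (pos_part_rv j) X0.
Proof.
move=> h j B mB.
have -> : X0 @^-1` B = X0 @^-1` (pos_part @^-1` B).
  by apply/seteqP; split => w /=; rewrite /pos_part max_r.
by rewrite -(h j) //; exact: measurable_pos_part_preimage.
Qed.

Lemma pos_part_rv_indep : independent_seq P Xs -> independent_seq P pos_part_rv.
Proof.
move=> h J B mB; apply: (h J (fun j => pos_part @^-1` B j)) => j.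
exact: measurable_pos_part_preimage.
Qed.

Lemma pos_part_rv_indep_pair : independent_sigma P (sigma_of_seq Xs)
    (sigma_of (fun w => (X0 w, K w))) ->
  independent_sigma P (sigma_of_seq pos_part_rv) (sigma_of (fun w => (X0 w, K w))).
Proof.
move=> h A B hA hB; apply: h => //.
move: A hA; apply: smallest_sub; first exact: smallest_sigma_algebra.
move=> A [j _ [B' mB' <-]]; apply: sub_sigma_algebra; exists j => //.
by exists (pos_part @^-1` B') => //; exact: measurable_pos_part_preimage.
Qed.

Lemma pos_part_rv_sum_law : (forall j, eq_in_law P P (Xs j) X0) ->
  eq_in_law P P (fun w => X0 w + \sum_(j < K w) Xs j w)
                (fun w => X0 w + \sum_(j < K w) pos_part_rv j w).
Proof.
move=> hid B mB.
set D := fun w => X0 w + \sum_(j < K w) Xs j w.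
set D' := fun w => X0 w + \sum_(j < K w) pos_part_rv j w.
pose E := \bigcup_j [set w | Xs j w < 0].
have mE : measurable E by apply: bigcup_measurable => j _; exact: measurable_ltr.
have E0 : P E = 0%E.
  apply/eqP; rewrite eq_le measure_ge0 andbT.
  have sub : (P E <= \sum_(0 <= j <oo) P [set w | (Xs j w < 0)%R])%E.
    by apply: measure_sigma_subadditive => // j; exact: measurable_ltr.
  apply: (le_trans sub).
  rewrite eseries0 // => j _ _.
  have := hid j `]-oo, 0[%classic (measurable_itv _).
  have -> : Xs j @^-1` `]-oo, 0[ = [set w | Xs j w < 0].
    by apply/seteqP; split => w /=; rewrite in_itv.
  have -> : X0 @^-1` `]-oo, 0[ = set0.
    by apply/seteqP; split => w //=; rewrite in_itv /= ltNge X0_ge0.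
  by rewrite measure0.
have DE w : ~ E w -> D w = D' w.
  move=> nE; rewrite /D /D'; congr (_ + _); apply: eq_bigr => j _ /=.
  rewrite /pos_part max_r // leNgt; apply/negP => h; apply: nE.
  by exists j.
have mD : measurable (D @^-1` B).
  by rewrite -[X in measurable X]setTI; exact: (measurable_compound X0 Xs K).
have mD' : measurable (D' @^-1` B).
  by rewrite -[X in measurable X]setTI; exact: (measurable_compound X0 pos_part_rv K).
have half (C C' : set T) : measurable C -> measurable C' -> (forall w, ~ E w -> C w -> C' w) ->
    (P C <= P C')%E.
  move=> mC mC' CC'; apply: (@le_trans _ _ (P (C' `|` E))).
    apply: le_measure; rewrite ?inE //; first exact: measurableU.
    by move=> w Cw; have [Ew|nE] := pselect (E w); [right|left; exact: CC'].
  apply: (@le_trans _ _ (P C' + P E)%E); first exact: measureU2.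
  by rewrite E0 adde0.
by apply/eqP; rewrite eq_le; apply/andP; split; apply: half => // w nE /=; rewrite DE.
Qed.

End PositivePart.

(** * The cluster sum *)

Theorem proposition5p1
  (R : realType)
  (dO dA dO' : measure_display)
  (Omega : measurableType dO) (P : probability Omega R)
  (AA : measurableType dA) (A : {RV P >-> AA})
  (f : {mfun AA >-> R}) (hf : forall a, 0 <= f a)
  (X : {RV P >-> R}) (hX : forall w, X w = f (A w))
  (K : {RV P >-> nat})
  (alpha : R) (halpha : 1 < alpha) (hnonint : alpha \isn't a Num.int)
  (hRV : regularly_varying_vector P (fun w => (X w, (K w)%:R)) alpha)
  (hEX : 'E_P[X]%E <> 0%E)
  (Xs : nat -> {RV P >-> R})
  (hident : forall j, eq_in_law P P (Xs j) X)
  (hindep : independent_seq P Xs)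
  (hindepXK : independent_sigma P (sigma_of_seq Xs)
                (sigma_of (fun w => (X w, K w))))
  (Omega' : measurableType dO') (P' : probability Omega' R)
  (DR : {RV P' >-> R})
  (hDR : eq_in_law P' P DR (fun w => X w + \sum_(j < K w) Xs j w)) :
  regularly_varying P' DR alpha /\
  asymp_equiv
    (fun x : R => fine (P' [set w | x < DR w]))
    (fun x : R =>
       fine (P [set w | x < X w + fine 'E_P[X]%E * (K w)%:R])
       + fine ('E_P[fun w => (K w)%:R])%E * fine (P [set w | x < X w])).
Proof.
have X_ge0 w : 0 <= X w by rewrite hX.
have a0 : 0 < alpha by apply: lt_trans halpha.
have [N [hN hW [a [mu [ha hmu _ hvague]]]]] := hRV.
pose V w : R * R := (X w, (K w)%:R).
pose W := N \o V.
have mW : measurable_fun setT W by exact: measurable_norm_vector.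
have W0 w : 0 <= W w by exact: norm_nonneg.
have HH : rv_tail (tail P W) alpha by exact: regularly_varying_tail.
have [Hm H0 HRV] := HH.
have mK : measurable_fun setT (fun w => (K w)%:R : R) by exact: measurable_natr.
(* above 1 for the law of large numbers, below alpha for a finite moment, and
   at most 2 for the exponential inequalities *)
pose b := Num.min 2 ((1 + alpha) / 2).
have b12 : 1 < b <= 2 by rewrite lt_min ge_min lexx andbT; lra.
have ba : b < alpha by rewrite gt_min; apply/orP; right; lra.
have b0 : 0 < b by case/andP: b12 => b1 _; exact: lt_trans b1.
have [|C1 C10 hC1] := @rv_tail_upper R (tail P W) alpha ((b + alpha) / 2) HH.
  by lra.
have WM : (\int[P]_w (W w `^ b)%:E < +oo)%E.
  by apply: (moment_of_tail mW W0 _ hC1); lra.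
have [C C0 hC] := coord_le_norm hN.
have XW w : X w <= C * W w.
  by have [h _] := hC (V w); exact: le_trans (ler_norm _) h.
have KW w : (K w)%:R <= C * W w.
  by have [_ h] := hC (V w); exact: le_trans (ler_norm _) h.
have XM : (\int[P]_w (X w `^ b)%:E < +oo)%E.
  by apply: (moment_dominated (W := W) (C := C)) => //; exact: ltW.
have KM : (\int[P]_w ((K w)%:R `^ b)%:E < +oo)%E.
  by apply: (moment_dominated (W := W) (C := C)) => //; exact: ltW.
have b1 : 1 <= b by case/andP: b12 => /ltW.
have X1 : (\int[P]_w (X w)%:E < +oo)%E by exact: (mean_of_moment _ _ b1).
have K1 : (\int[P]_w ((K w)%:R%:E : \bar R) < +oo)%E by exact: (mean_of_moment _ _ b1).
have X10 : (0 <= \int[P]_w (X w)%:E)%E by apply: integral_ge0 => w _; rewrite lee_fin.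
have EXE : ('E_P[X] = \int[P]_w (X w)%:E)%E by rewrite unlock.
have EKE : ('E_P[fun w => (K w)%:R] = \int[P]_w (K w)%:R%:E)%E by rewrite unlock.
pose m := fine ('E_P[X])%E; pose M := fine (\int[P]_w (X w `^ b)%:E)%E.
have hm : (\int[P]_w (X w)%:E = m%:E)%E by rewrite /m EXE fineK // ge0_fin_numE.
have hM : (\int[P]_w (X w `^ b)%:E = M%:E)%E.
  by rewrite fineK // ge0_fin_numE // integral_ge0 // => w _; rewrite lee_fin powR_ge0.
have m0 : 0 < m.
  rewrite lt_neqAle -lee_fin -hm X10 andbT; apply/eqP => m0.
  by apply: hEX; rewrite EXE hm -m0.
have lin u v : 0 <= u -> 0 <= v -> exists c : R,
    tail P (fun w => u * X w + v * (K w)%:R) x / tail P W x @[x --> +oo] --> c.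
  by move=> u0 v0; exact: (linear_tail_cvg X_ge0 hN hW ha hmu hvague u0 v0).
have [c1 hc1] : exists c : R, tail P X x / tail P W x @[x --> +oo] --> c.
  have [c hc] := lin 1 0 ler01 (lexx 0); exists c.
  by move: hc; under eq_fun do (under [fun w => _]eq_fun do rewrite mul1r mul0r addr0).
have [cT hcT] : exists c : R,
    tail P (fun w => X w + m * (K w)%:R) x / tail P W x @[x --> +oo] --> c.
  have [c hc] := lin 1 m ler01 (ltW m0); exists c.
  by move: hc; under eq_fun do (under [fun w => _]eq_fun do rewrite mul1r).
have mT : measurable_fun setT (fun w => X w + m * (K w)%:R) by exact: measurable_lin.
(* [X + m K] dominates the norm up to a constant, hence its tail dominates [H] *)
have cT0 : 0 < cT.
  pose C2 := N (1, 0) + N (0, 1) / m + 1.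
  have n1 : 0 <= N (1, 0) by exact: norm_nonneg.
  have n2 : 0 <= N (0, 1) / m by rewrite divr_ge0 ?(ltW m0) //; exact: norm_nonneg.
  have C20 : 0 < C2 by rewrite /C2; lra.
  have WT w : W w <= C2 * (X w + m * (K w)%:R).
    apply: (le_trans (norm_le_coord _ hN)); rewrite /= !ger0_norm //.
    have -> : (K w)%:R * N (0, 1) = N (0, 1) / m * (m * (K w)%:R).
      by field; rewrite gt_eqF.
    have mk0 : 0 <= m * (K w)%:R by rewrite mulr_ge0 // ltW.
    have q1 : 0 <= N (1, 0) * (m * (K w)%:R) by rewrite mulr_ge0.
    have q2 : 0 <= N (0, 1) / m * X w by rewrite mulr_ge0.
    have := X_ge0 w; rewrite /C2; lra.
  pose q := C2 `^ (- alpha); have q0 : 0 < q by rewrite powR_gt0.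
  apply: (@lt_le_trans _ _ (q / 2)); first by rewrite divr_gt0.
  have cv : cvg (tail P (fun w => X w + m * (K w)%:R) x / tail P W x @[x --> +oo]).
    by apply/cvg_ex; exists cT.
  rewrite -(cvg_lim _ hcT) //; apply: limr_ge => //.
  near=> x; apply: (@le_trans _ _ (tail P W (C2 * x) / tail P W x)).
    apply: ltW; near: x; apply: (cvgr_gt _ (HRV _ C20)).
    by rewrite ltr_pdivrMr // ltr_pMr // ltr1n.
  rewrite ler_pM2r ?invr_gt0 //; apply: le_tail => // w h.
  by rewrite -(ltr_pM2l C20); exact: lt_le_trans (WT w).
have c10 : 0 <= c1 by exact: (ratio_lim_ge0 HH hc1).
pose X' := pos_part_rv Xs.
have X'ident := pos_part_rv_ident X_ge0 hident.
have lim := compound_tail X_ge0 (pos_part_rv_ge0 Xs) X'ident (pos_part_rv_indep hindep)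
  (pos_part_rv_indep_pair hindepXK) HH halpha hc1 b12 m0 hm hM K1 hcT.
set D' := (fun w => X w + \sum_(j < K w) X' j w).
have lawD B : measurable B -> P' (DR @^-1` B) = P (D' @^-1` B).
  by move=> mB; rewrite hDR // (pos_part_rv_sum_law X_ge0).
have tailE x : tail P' DR x = tail P D' x by rewrite /tail /pr !gt_setE lawD.
set EK := fine (\int[P]_w ((K w)%:R%:E : \bar R))%E in lim.
pose c := cT + EK * c1.
have EK0 : 0 <= EK.
  by rewrite fine_ge0 // integral_ge0 // => w _; rewrite lee_fin.
have c0 : 0 < c by rewrite ltr_wpDr // mulr_ge0.
have limDR : tail P' DR x / tail P W x @[x --> +oo] --> c.
  by under eq_fun do rewrite tailE.
split.
- apply: tail_regularly_varying => //.
    exists [set w | DR w < 0]; split.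
    + exact: measurable_ltr.
    + have -> : [set w | DR w < 0] = DR @^-1` `]-oo, 0[%classic.
        by apply/seteqP; split => w /=; rewrite in_itv.
      rewrite lawD // (_ : D' @^-1` _ = set0) ?measure0 //.
      apply/seteqP; split => w //=; rewrite in_itv /= ltNge addr_ge0 //.
      by apply: sumr_ge0 => j _; exact: pos_part_rv_ge0.
    + by move=> w /= h; rewrite ltNge; apply/negP.
  by apply: (rv_tail_equiv HH _ c0 limDR) => x y; exact: tail_nincr.
- rewrite /asymp_equiv EKE -/m.
  pose F x := tail P (fun w => X w + m * (K w)%:R) x + EK * tail P X x.
  have limF : F x / tail P W x @[x --> +oo] --> c.
    have -> : (fun x => F x / tail P W x) =
        (fun x => tail P (fun w => X w + m * (K w)%:R) x / tail P W x +
                  EK * (tail P X x / tail P W x)).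
      by apply/funext => x; rewrite /F mulrDl mulrA.
    by apply: cvgD => //; apply: cvgM => //; exact: cvg_cst.
  have h : (tail P' DR x / tail P W x) / (F x / tail P W x) @[x --> +oo] --> c / c.
    by apply: cvgM => //; apply: cvgV => //; rewrite gt_eqF.
  rewrite mulfV ?gt_eqF // in h.
  apply: cvg_trans h; apply: near_eq_cvg; near=> x.
  by rewrite /= invf_div mulrA divfK // gt_eqF.
Unshelve. all: by end_near. Qed.
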